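(* Let $\ell$ be a fixed positive integer. Then there exist constants $C_\ell>0$ and $T_0(\ell)$, depending only on $\ell$, such that for all $T\ge T_0(\ell)$, $$ \max_{t \in [\sqrt{T},T]}\prod_{j=1}^\ell |\zeta(1+ijt)| \ge e^{\ell \gamma} \Big\{(\log_2 T)^\ell + \ell (\log_2 T)^{\ell -1}\log_3 T - C_\ell\,(\log_2 T)^{\ell -1} \Big\}. $$ Equivalently, $\max_{t \in [\sqrt{T},T]}\prod_{j=1}^\ell |\zeta(1+ijt)| \ge e^{\ell \gamma} \{(\log_2 T)^\ell + \ell (\log_2 T)^{\ell -1}\log_3 T + O_\ell((\log_2 T)^{\ell -1}) \}$ for sufficiently large $T$, where the implied constant depends only on $\ell$.
   Context: $\zeta$ denotes the Riemann zeta function, $\gamma$ is the Euler–Mascheroni constant, and $\log_k$ denotes the $k$-fold iterated logarithm (so $\log_2 T=\log\log T$, $\log_3 T=\log\log\log T$). *)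

(* Defs.v *)
From Stdlib Require Import Reals.
From Coquelicot Require Import Coquelicot.
Open Scope R_scope.

Definition euler_gamma : R :=
  real (Lim_seq (fun N => sum_f_R0 (fun k => / INR (k + 1)) N - ln (INR (N + 1)))).

(* zeta(1 + i u), u <> 0, via the (standard, valid for Re s > 0, s <> 1) formula
   zeta(s) = lim_{N->oo} ( sum_{n=1}^N n^{-s} - N^{1-s}/(1-s) ).
   For s = 1 + i u:  n^{-s} = (cos(u ln n) - i sin(u ln n))/n  and
   N^{1-s}/(1-s) = (sin(u ln N) + i cos(u ln N))/u. *)
Definition zeta1_re (u : R) : R :=
  real (Lim_seq (fun N =>
    sum_f_R0 (fun k => cos (u * ln (INR (k + 1))) / INR (k + 1)) N
    - sin (u * ln (INR (N + 1))) / u)).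

Definition zeta1_im (u : R) : R :=
  real (Lim_seq (fun N =>
    - sum_f_R0 (fun k => sin (u * ln (INR (k + 1))) / INR (k + 1)) N
    - cos (u * ln (INR (N + 1))) / u)).

Definition zeta1_abs (u : R) : R :=
  sqrt (zeta1_re u ^ 2 + zeta1_im u ^ 2).

Fixpoint prodR (f : nat -> R) (n : nat) : R :=
  match n with
  | O => 1
  | S m => prodR f m * f (S m)
  end.

(* Main.v *)
Require Import Defs.
From Stdlib Require Import Reals.
From Coquelicot Require Import Coquelicot.
From Stdlib Require Import Lra Classical_Prop.
From HB Require Import structures.
From mathcomp Require ssreflect ssrfun ssrbool eqtype ssrnat seq div prime fintype bigop binomial.
Open Scope R_scope.

(* Resonance method. Put r(p) = 1 - p/x for p <= x, with x = c log T log log T, and let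
   Q(t) = prod_{p <= x} |1 - r(p) p^(it)|^(-2), which has nonnegative Fourier coefficients.
   For n = prod p^(k_p) composed of primes p <= x, the function n^(-it) Q - r(n) Q, with
   r(n) = prod r(p)^(k_p), again has nonnegative coefficients. With the positive definite weight
   on the integers t = a - b (0 <= a, b < K = floor T), the Q-average of
   prod_j sum_{n <= N} n^(-1-ijt) is therefore at least prod_j sum_n r(n)^j / n, which by
   Mertens' theorem is at least e^(l gamma) (log x - O(1))^l. The small |t| contribute
   little because Q <= T^(1/4), and for |t| >= sqrt T the Dirichlet sums approximate zeta.
   Only a lower bound is needed in Mertens' theorem; its constant e^gamma comes from
   comparing the Laplace transforms of the prime sum -log(1 - 1/p) and of the harmonic
   sums. *)

(* The mathcomp notations stay inside a module, since [<=] on [nat] would otherwise change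
   meaning in the theorem. *)
Module LargeValues.

Import ssreflect ssrfun ssrbool eqtype ssrnat seq div prime fintype bigop binomial.
Set Implicit Arguments. Unset Strict Implicit. Unset Printing Implicit Defensive.
Local Open Scope R_scope.

(** The shape of r(p) = 1 - p/x is a compromise between two costs. The maximum of Q is governed by 1
    - r(p) = p/x: its logarithm is at most 2 sum log(x/p) = O(x / log x), whereas r(p) close to 1 at
    every prime would cost a further logarithm. On the other side, replacing 1/p by r(p)^j / p loses
    at most j/x, uniformly in p, so all primes together lose O(1 / log x) in the logarithm of the
    Euler product, which is O(1) after multiplication by log x. Hence x may be as large as c log T
    log log T, and log x = log_2 T + log_3 T + O(1) is the origin of the second main term. For the
    same reason Mertens' theorem is needed with error O(1 / log x) and with the exact constant.
    Chebyshev-type estimates control only the growth of the prime sum between two points; a deficit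
    at x would therefore persist at every later point, and the behaviour of zeta(1+s) as s -> 0
    excludes this. Averaging over differences of integers replaces integrals by finite sums: on a
    character the average is a squared modulus. *)

HB.instance Definition _ := Monoid.isComLaw.Build R 0 Rplus
  (fun x y z => esym (Rplus_assoc x y z)) Rplus_comm Rplus_0_l.
HB.instance Definition _ := Monoid.isComLaw.Build R 1 Rmult
  (fun x y z => esym (Rmult_assoc x y z)) Rmult_comm Rmult_1_l.
HB.instance Definition _ := Monoid.isMulLaw.Build R 0 Rmult Rmult_0_l Rmult_0_r.
HB.instance Definition _ := Monoid.isAddLaw.Build R Rmult Rplus
  (fun x y z => Rmult_plus_distr_r x y z) (fun x y z => Rmult_plus_distr_l x y z).

Local Notation "\sum_ ( i <- r | P ) F" := (\big[Rplus/0]_(i <- r | P%B) F) : R_scope.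
Local Notation "\sum_ ( i <- r ) F" := (\big[Rplus/0]_(i <- r) F) : R_scope.
Local Notation "\sum_ ( m <= i < n | P ) F" := (\big[Rplus/0]_(m%N <= i < n%N | P%B) F) : R_scope.
Local Notation "\sum_ ( m <= i < n ) F" := (\big[Rplus/0]_(m%N <= i < n%N) F) : R_scope.
Local Notation "\prod_ ( i <- r | P ) F" := (\big[Rmult/1]_(i <- r | P%B) F) : R_scope.
Local Notation "\prod_ ( i <- r ) F" := (\big[Rmult/1]_(i <- r) F) : R_scope.
Local Notation "\prod_ ( m <= i < n ) F" := (\big[Rmult/1]_(m%N <= i < n%N) F) : R_scope.

(** * Finite sums and products of reals *)

Lemma sum_le (I : eqType) (r : seq I) (P : pred I) (F G : I -> R) :
  (forall i, i \in r -> P i -> F i <= G i) ->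
  \sum_(i <- r | P i) F i <= \sum_(i <- r | P i) G i.
Proof.
move=> h; rewrite [X in X <= _]big_seq_cond [X in _ <= X]big_seq_cond.
by apply: (big_ind2 (fun x y => x <= y)) => [|*|i /andP[]]; [lra|lra|exact: h].
Qed.

Lemma sum_ge0 (I : eqType) (r : seq I) (P : pred I) (F : I -> R) :
  (forall i, i \in r -> P i -> 0 <= F i) -> 0 <= \sum_(i <- r | P i) F i.
Proof.
move=> h; rewrite big_seq_cond.
by apply: (big_ind (fun x => 0 <= x)) => [|*|i /andP[]]; [lra|lra|exact: h].
Qed.

Lemma prod_gt0 (I : eqType) (r : seq I) (P : pred I) (F : I -> R) :
  (forall i, i \in r -> P i -> 0 < F i) -> 0 < \prod_(i <- r | P i) F i.
Proof.
move=> h; rewrite big_seq_cond.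
apply: (big_ind (fun x => 0 < x)) => [|x y|i /andP[]]; [lra| |exact: h].
exact: Rmult_lt_0_compat.
Qed.

Lemma prod_le (I : eqType) (r : seq I) (P : pred I) (F G : I -> R) :
  (forall i, i \in r -> P i -> 0 <= F i <= G i) ->
  0 <= \prod_(i <- r | P i) F i <= \prod_(i <- r | P i) G i.
Proof.
move=> h; rewrite (@big_seq_cond _ _ _ _ r P F) (@big_seq_cond _ _ _ _ r P G).
apply: (big_ind2 (fun x y => 0 <= x <= y)) => [|x1 x2 y1 y2 h1 h2|i /andP[]]; [lra| |exact: h].
split; [apply: Rmult_le_pos; lra | apply: Rmult_le_compat; lra].
Qed.

Lemma sum_const (I : Type) (r : seq I) (P : pred I) (c : R) :
  \sum_(i <- r | P i) c = INR (count P r) * c.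
Proof.
elim: r => [|i r ih]; first by rewrite big_nil /= Rmult_0_l.
rewrite big_cons /= ih; case: (P i) => //.
by rewrite add1n S_INR; ring.
Qed.

Lemma ln_prod (I : eqType) (r : seq I) (P : pred I) (F : I -> R) :
  (forall i, i \in r -> P i -> 0 < F i) ->
  ln (\prod_(i <- r | P i) F i) = \sum_(i <- r | P i) ln (F i).
Proof.
move=> h.
suff [] : 0 < \prod_(i <- r | P i) F i /\
          ln (\prod_(i <- r | P i) F i) = \sum_(i <- r | P i) ln (F i) by [].
rewrite big_seq_cond [X in _ = X]big_seq_cond.
apply: (big_rec2 (fun x y => 0 < x /\ ln x = y)); first by split; [lra|exact: ln_1].
move=> i y1 y2 /andP[ir Pi] [h1 <-]; have h2 := h _ ir Pi; split.
- exact: Rmult_lt_0_compat.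
- exact: ln_mult.
Qed.

Lemma sum_subset (I : eqType) (s s' : seq I) (F : I -> R) :
  uniq s -> {subset s <= s'} -> (forall i, i \in s' -> 0 <= F i) ->
  \sum_(i <- s) F i <= \sum_(i <- s') F i.
Proof.
elim: s s' => [|a s ih] s' /=; first by move=> _ _ h; rewrite big_nil; apply: sum_ge0 => i hi _; exact: h.
move=> /andP[ha hu] hs h.
have ha' : a \in s' by apply: hs; rewrite inE eqxx.
rewrite big_cons (perm_big _ (perm_to_rem ha')) big_cons /=.
suff : \sum_(i <- s) F i <= \sum_(i <- rem a s') F i by lra.
apply: ih => // i hi; last by apply: h; exact: mem_rem hi.
have hia : i != a by apply: contraNneq ha => <-.
have := hs i; rewrite inE hi orbT => /(_ isT).
by rewrite (perm_mem (perm_to_rem ha')) inE (negbTE hia).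
Qed.

(** * Sums over primes: Chebyshev and Mertens *)

Lemma leq_INR m n : (m <= n)%N -> INR m <= INR n.
Proof. by move=> /leP; exact: le_INR. Qed.

Lemma ltn_INR m n : (m < n)%N -> INR m < INR n.
Proof. by move=> /ltP; exact: lt_INR. Qed.

Lemma INR_gt0 n : (0 < n)%N -> 0 < INR n.
Proof. by move=> /ltn_INR. Qed.

Lemma INR_ge1 n : (0 < n)%N -> 1 <= INR n.
Proof. by move=> /leq_INR. Qed.

Lemma INR_addn m n : INR (m + n) = INR m + INR n.
Proof. exact: plus_INR. Qed.

Lemma INR_muln m n : INR (m * n) = INR m * INR n.
Proof. exact: mult_INR. Qed.

Lemma INR_expn m n : INR (m ^ n) = INR m ^ n.
Proof. by elim: n => [|n ih] //; rewrite expnS INR_muln ih. Qed.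

Lemma ln_INR_ge0 n : (0 < n)%N -> 0 <= ln (INR n).
Proof. by move=> /INR_ge1 h; rewrite -ln_1; apply: ln_le; lra. Qed.

Lemma ln_INR_le m n : (0 < m)%N -> (m <= n)%N -> ln (INR m) <= ln (INR n).
Proof. by move=> /INR_gt0 h /leq_INR; exact: ln_le. Qed.

Lemma ln_le_sub1 x : 0 < x -> ln x <= x - 1.
Proof. by move=> hx; have := exp_ineq1_le (ln x); rewrite exp_ln //; lra. Qed.

Lemma sum_nat_recr (m n : nat) (F : nat -> R) : (m <= n)%N ->
  \sum_(m <= i < n.+1) F i = \sum_(m <= i < n) F i + F n.
Proof. exact: big_nat_recr. Qed.

Lemma sum_recr_from (m n : nat) (P : pred nat) (F : nat -> R) : (m <= n)%N ->
  \sum_(m <= i < n.+1 | P i) F i =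
  \sum_(m <= i < n | P i) F i + (if P n then F n else 0).
Proof. by move=> h; rewrite big_mkcond big_nat_recr //= -big_mkcond. Qed.

Lemma sum_recr (n : nat) (P : pred nat) (F : nat -> R) :
  \sum_(1 <= i < n.+2 | P i) F i =
  \sum_(1 <= i < n.+1 | P i) F i + (if P n.+1 then F n.+1 else 0).
Proof. exact: sum_recr_from. Qed.

Lemma ln_logn M n : (0 < n)%N -> (forall p, prime p -> p %| n -> p <= M)%N ->
  ln (INR n) = \sum_(1 <= p < M.+1 | prime p) INR (logn p n) * ln (INR p).
Proof.
have [k] := ubnP n; elim: k n => // k ih n.
rewrite ltnS => hk n0 hM.
have [n1|] := leqP n 1.
  have -> : n = 1%N by apply/eqP; rewrite eqn_leq n1.
  rewrite ln_1 big1 // => p _; rewrite logn1; exact: Rmult_0_l.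
move=> n1; set p := pdiv n; have pp : prime p by exact: pdiv_prime.
have pn : (p %| n)%N by exact: pdiv_dvd.
have pM : (p <= M)%N by exact: hM.
have p0 := prime_gt0 pp.
case/dvdnP: pn => m nE; have m0 : (0 < m)%N by move: n0; rewrite nE muln_gt0 => /andP[].
have mn : (m < n)%N by rewrite nE ltn_Pmulr // prime_gt1.
rewrite {1}nE INR_muln ln_mult; [|exact: INR_gt0|exact: INR_gt0].
rewrite (ih m) //; first last.
- by move=> q hq qm; apply: hM => //; rewrite nE dvdn_mulr.
- exact: leq_trans mn hk.
transitivity (\sum_(1 <= q < M.+1 | prime q) (INR (logn q m) * ln (INR q)) +
  \sum_(1 <= q < M.+1 | prime q) (if q == p then ln (INR q) else 0)).
  congr (_ + _); rewrite big_mkcond (bigD1_seq p) /= ?mem_index_iota ?ltnS ?p0 ?iota_uniq //.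
  rewrite pp eqxx big1 ?Rplus_0_r // => q /negbTE ->; by case: (prime q).
rewrite -big_split /=; apply: eq_bigr => q hq.
rewrite nE lognM // (logn_prime _ pp) INR_addn.
by case: eqP => _ /=; ring.
Qed.

Lemma prime_dvd_fact p k : prime p -> (p %| k`!)%N -> (p <= k)%N.
Proof.
move=> pp; elim: k => [|k ih]; first by rewrite dvdn1 => /eqP h; rewrite h in pp.
rewrite factS Euclid_dvdM // => /orP[/dvdn_leq -> //|/ih]; exact: leqW.
Qed.

(** The two equal middle coefficients both occur in the expansion of (1 + 1)^(2m+1) = 2 * 4^m. *)
Lemma bin_mid_le m : ('C(m.*2.+1, m) <= 4 ^ m)%N.
Proof.
rewrite -(@leq_pmul2l 2) //.
have -> : (2 * 4 ^ m = (1 + 1) ^ (m.*2.+1))%N by rewrite expnS -mul2n expnM.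
rewrite expnDn.
have hm : (m < m.*2.+2)%N by rewrite ltnS -addnn leqW // leq_addr.
have hm1 : (m.+1 < m.*2.+2)%N by rewrite !ltnS -addnn leq_addr.
rewrite (bigD1 (Ordinal hm)) //= (bigD1 (Ordinal hm1)) /=; last first.
  by rewrite -val_eqE /= neq_ltn ltnSn orbT.
rewrite !exp1n !muln1.
have -> : 'C(m.*2.+1, m.+1) = 'C(m.*2.+1, m).
  by rewrite -bin_sub; [congr 'C(_, _); rewrite subSS -addnn addnK|rewrite ltnS -addnn leq_addr].
by rewrite mul2n -addnn addnA leq_addr.
Qed.

Lemma ln4_le2 : ln 4 <= 2.
Proof.
rewrite (_ : 4 = 2 ^ 2); last by ring.
by rewrite ln_pow; [have := @ln_le_sub1 2; rewrite /=; lra|lra].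
Qed.

Definition theta n := \sum_(1 <= p < n.+1 | prime p) ln (INR p).

Lemma prime_ln_ge0 p : prime p -> 0 <= ln (INR p).
Proof. by move=> /prime_gt0; exact: ln_INR_ge0. Qed.

(** Each prime in [m+2, 2m+1] divides (2m+1)! but neither m! nor (m+1)!, so it divides the middle
    binomial coefficient, whose logarithm is at most m log 4. *)
Lemma theta_mid m : theta m.*2.+1 <= theta m.+1 + INR m * ln 4.
Proof.
have hle : (m.+2 <= m.*2.+2)%N by rewrite !ltnS -addnn leq_addr.
rewrite /theta (@big_cat_nat _ _ _ m.+2) //=.
apply: Rplus_le_compat_l.
have b0 : (0 < 'C(m.*2.+1, m))%N by rewrite bin_gt0 -addnn leqW // leq_addr.
have hb := @bin_fact m.*2.+1 m.
have {}hb : ('C(m.*2.+1, m) * (m`! * (m.+1)`!))%N = (m.*2.+1)`!.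
  rewrite -hb; last by rewrite -addnn leqW // leq_addr.
  by congr (_ * (_ * _`!))%N; rewrite subSn -addnn ?leq_addr // addnK.
apply: (Rle_trans _ (ln (INR 'C(m.*2.+1, m)))); last first.
  apply: (Rle_trans _ (ln (INR (4 ^ m)))); first by apply: ln_INR_le => //; exact: bin_mid_le.
  rewrite INR_expn ln_pow; [|exact: INR_gt0].
  by right; congr (_ * ln _); rewrite /=; ring.
rewrite (@ln_logn m.*2.+1) //; last first.
  by move=> p pp hp; apply: prime_dvd_fact => //; rewrite -hb dvdn_mulr.
rewrite [X in _ <= X](@big_cat_nat _ _ _ m.+2) //=.
have h0 : 0 <= \sum_(1 <= p < m.+2 | prime p) INR (logn p 'C(m.*2.+1, m)) * ln (INR p).
  by apply: sum_ge0 => p _ pp; apply: Rmult_le_pos; [exact: pos_INR|exact: prime_ln_ge0].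
suff : \sum_(m.+2 <= p < m.*2.+2 | prime p) ln (INR p) <=
  \sum_(m.+2 <= p < m.*2.+2 | prime p) INR (logn p 'C(m.*2.+1, m)) * ln (INR p) by lra.
apply: sum_le => p; rewrite mem_index_iota => /andP[p1 p2] pp.
rewrite -{1}(Rmult_1_l (ln _)); apply: Rmult_le_compat_r; first exact: prime_ln_ge0.
apply: INR_ge1; rewrite logn_gt0 mem_primes pp b0 /=.
have : (p %| (m.*2.+1)`!)%N by apply: dvdn_fact; rewrite prime_gt0.
rewrite -hb (Euclid_dvdM _ _ pp) (Euclid_dvdM _ _ pp) => /or3P[//| |] hf.
- by have := leq_trans p1 (leqW (prime_dvd_fact pp hf)); rewrite ltnn.
- by have := leq_trans p1 (prime_dvd_fact pp hf); rewrite ltnn.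
Qed.

Lemma thetaS n : theta n.+1 = theta n + (if prime n.+1 then ln (INR n.+1) else 0).
Proof. exact: sum_recr. Qed.

(** Strong induction: an even number above 2 adds no prime, and an odd 2m+1 reduces to m+1, with
    (m+1) + m = 2m+1 in the bound. *)
Lemma theta_le n : theta n <= INR n * ln 4.
Proof.
have l4 : 0 < ln 4 by rewrite -ln_1; apply: ln_increasing; lra.
have [k] := ubnP n; elim: k n => // k ih [|[|[|n]]].
- by move=> _; rewrite /theta big_geq // Rmult_0_l; lra.
- by move=> _; rewrite thetaS /theta big_geq //=; lra.
- move=> _; rewrite !thetaS /theta big_geq //=.
  have : ln 2 <= ln 4 by apply: ln_le; lra.
  have -> : (1 + 1) = 2 by ring.
  lra.
rewrite ltnS => hk.
case: (boolP (odd n)) => ho.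
  have /negbTE hp : ~~ prime n.+3.
    by apply/negP => /primeP[_ /(_ 2%N)]; rewrite dvdn2 /= ho /= => /(_ isT).
  rewrite thetaS hp Rplus_0_r.
  apply: (Rle_trans _ _ _ (ih _ _)); first exact: leq_trans hk.
  apply: Rmult_le_compat_r; first lra.
  by apply: leq_INR.
have en : n.+3 = (n./2.+1).*2.+1 by rewrite doubleS -[in LHS](odd_double_half n) (negbTE ho).
rewrite en; apply: Rle_trans (theta_mid _) _.
have := ih (n./2.+2); rewrite en in hk.
have hlt : (n./2.+2 < k)%N by apply: leq_trans hk; rewrite doubleS !ltnS -addnn leq_addr.
move=> /(_ hlt) h.
have -> : INR (n./2.+1).*2.+1 = INR n./2.+2 + INR n./2.+1.
  by rewrite -INR_addn -addnn -addSn.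
lra.
Qed.

Lemma prime_INR_ge2 p : prime p -> 2 <= INR p.
Proof. by move=> /prime_gt1 /leq_INR. Qed.

Lemma ln_step n : (0 < n)%N -> / INR n.+1 <= ln (INR n.+1) - ln (INR n) <= / INR n.
Proof.
move=> n0; have h := INR_gt0 n0; have h1 : 0 < INR n.+1 by exact: INR_gt0.
have e : INR n.+1 = INR n + 1 by exact: S_INR.
rewrite -ln_div //; split; last first.
  apply: Rle_trans (ln_le_sub1 (Rdiv_lt_0_compat _ _ h1 h)) _.
  by right; rewrite e; field; lra.
have -> : INR n.+1 / INR n = / (INR n / INR n.+1) by field; lra.
rewrite ln_Rinv; last exact: Rdiv_lt_0_compat.
have := ln_le_sub1 (Rdiv_lt_0_compat _ _ h h1).
have -> : INR n / INR n.+1 - 1 = - / INR n.+1 by rewrite e; field; lra.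
lra.
Qed.

Lemma ln_fact_bounds n : (0 < n)%N ->
  INR n * ln (INR n) - INR n <= ln (INR n`!) <= INR n * ln (INR n).
Proof.
elim: n => // -[_ _|n ih _]; first by rewrite (_ : 1`! = 1%N) //= ln_1; lra.
have [h1 h2] := ih isT.
rewrite factS INR_muln ln_mult; [|exact: INR_gt0|by apply: INR_gt0; rewrite fact_gt0].
have h := ln_step (ltn0Sn n); have p := INR_gt0 (ltn0Sn n).
have e : INR n.+2 = INR n.+1 + 1 by exact: S_INR.
have : INR n.+1 * (ln (INR n.+2) - ln (INR n.+1)) <= 1.
  rewrite -(Rinv_r (INR n.+1)); [apply: Rmult_le_compat_l|]; lra.
have : 0 <= INR n.+1 * (ln (INR n.+2) - ln (INR n.+1)).
  apply: Rmult_le_pos; first lra.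
  by have := Rinv_0_lt_compat _ (INR_gt0 (ltn0Sn n.+1)); lra.
rewrite e; nra.
Qed.

Lemma sum_telescope_le (m n : nat) (f g : nat -> R) : (m <= n)%N ->
  (forall k, (m <= k < n)%N -> f k <= g k.+1 - g k) ->
  \sum_(m <= k < n) f k <= g n - g m.
Proof.
elim: n => [|n ih]; first by rewrite leqn0 => /eqP -> _; rewrite big_geq //; lra.
rewrite leq_eqVlt => /orP[/eqP -> _|]; first by rewrite big_geq //; lra.
rewrite ltnS => mn h; rewrite big_nat_recr //=.
have := h n; rewrite mn ltnSn => /(_ isT).
have : \sum_(m <= k < n) f k <= g n - g m.
  by apply: ih => // k /andP[k1 k2]; apply: h; rewrite k1 ltnW.
lra.
Qed.

Lemma INR_divn_le n d : (0 < d)%N -> INR n / INR d - 1 <= INR (n %/ d) <= INR n / INR d.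
Proof.
move=> d0; have h := INR_gt0 d0.
have e : INR n = INR (n %/ d) * INR d + INR (n %% d).
  by rewrite {1}(divn_eq n d) INR_addn INR_muln.
have := ltn_INR (ltn_pmod n d0); have := pos_INR (n %% d) => h1 h2.
have e2 : INR n / INR d = INR (n %/ d) + INR (n %% d) / INR d by rewrite e; field; lra.
have : 0 <= INR (n %% d) / INR d <= 1.
  split; first by apply: Rdiv_le_0_compat.
  by apply/Rle_div_l => //; lra.
lra.
Qed.

(** Legendre's formula: the first term alone gives the lower bound, the full geometric series the
    upper one. *)
Lemma logn_fact_bounds n p : prime p -> (0 < n)%N ->
  INR n / INR p - 1 <= INR (logn p n`!) <= INR n / (INR p - 1).
Proof.
move=> pp n0; have p1 := prime_INR_ge2 pp.
have p0 : (0 < p)%N by exact: prime_gt0.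
rewrite logn_fact //; split.
  have [h _] := INR_divn_le n p0; apply: Rle_trans h _; apply: leq_INR.
  by rewrite big_ltn ?ltnS // expn1 leq_addr.
have -> : INR (\sum_(1 <= k < n.+1) n %/ p ^ k)%N = \sum_(1 <= k < n.+1) INR (n %/ p ^ k).
  by elim/big_rec2: _ => // k x y _ <-; rewrite INR_addn.
(* Minus the tail of the geometric series from exponent k on, so that g(k+1) - g(k) = n / p^k. *)
pose g k := - (INR n / (INR p - 1)) * / INR p ^ k.-1.
apply: (Rle_trans _ (g n.+1 - g 1%N)); last first.
  rewrite /g /= Rinv_1.
  have : 0 <= INR n / (INR p - 1) * / INR p ^ n; last lra.
  apply: Rmult_le_pos; first by apply: Rdiv_le_0_compat; [exact: pos_INR|lra].
  by left; apply: Rinv_0_lt_compat; apply: pow_lt; lra.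
apply: sum_telescope_le => // -[//|k] _.
have pk : (0 < p ^ k.+1)%N by rewrite expn_gt0 p0.
have [_ h] := INR_divn_le n pk; apply: Rle_trans h _.
right; rewrite /g INR_expn /=; field.
have : INR p ^ k <> 0 by apply: pow_nonzero; lra.
by repeat split; lra.
Qed.

Definition lnp_sum n := \sum_(1 <= p < n.+1 | prime p) ln (INR p) / INR p.

Lemma fact_logn n : ln (INR n`!) = \sum_(1 <= p < n.+1 | prime p) INR (logn p n`!) * ln (INR p).
Proof. by apply: ln_logn; [rewrite fact_gt0|move=> p; exact: prime_dvd_fact]. Qed.

(** Upper half of Mertens' first theorem. Insert v_p(n!) >= n/p - 1 into log n! = sum v_p(n!) log p,
    use log n! <= n log n, and bound the resulting [theta n] by Chebyshev. *)
Lemma lnp_sum_le n : (0 < n)%N -> lnp_sum n <= ln (INR n) + ln 4.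
Proof.
move=> n0; have h := INR_gt0 n0.
have h1 : INR n * lnp_sum n - theta n <= ln (INR n`!).
  rewrite fact_logn /lnp_sum /theta big_distrr /=.
  suff : INR n * lnp_sum n <= ln (INR n`!) + theta n.
    by rewrite fact_logn /lnp_sum /theta big_distrr /=; lra.
  rewrite fact_logn /theta -big_split /lnp_sum big_distrr /=.
  apply: sum_le => p _ pp.
  have [h1 _] := logn_fact_bounds pp n0; have := prime_ln_ge0 pp => h2.
  have := Rmult_le_compat_r _ _ _ h2 h1.
  by rewrite /Rdiv; lra.
have h2 := theta_le n; have [_ h3] := ln_fact_bounds n0.
apply: (Rmult_le_reg_l (INR n)) => //; lra.
Qed.

Lemma lnp_tail n : (0 < n)%N ->
  \sum_(1 <= p < n.+1 | prime p) ln (INR p) / (INR p * (INR p - 1)) <= 2.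
Proof.
move=> n0.
(* The strengthened bound is chosen so that its increment exceeds log n / (n (n - 1)) for every
   integer n >= 2, prime or not. *)
suff : \sum_(1 <= p < n.+1 | prime p) ln (INR p) / (INR p * (INR p - 1)) <=
    2 - (ln (INR n) + 2) / INR n.
  have : 0 <= (ln (INR n) + 2) / INR n; last lra.
  by apply: Rdiv_le_0_compat; [have := ln_INR_ge0 n0; lra|exact: INR_gt0].
elim: n n0 => // -[_ _|n ih _].
  by rewrite big_ltn_cond // big_geq //= ln_1; lra.
rewrite sum_recr; have {}ih := ih isT.
have p1 := INR_ge1 (ltn0Sn n); have e : INR n.+2 = INR n.+1 + 1 by exact: S_INR.
have l2 : 0 <= ln (INR n.+2) by apply: ln_INR_ge0.
apply: (Rle_trans _ (2 - (ln (INR n.+1) + 2) / INR n.+1 + ln (INR n.+2) / (INR n.+2 * (INR n.+2 - 1)))).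
  apply: Rplus_le_compat => //; case: ifP => _; first lra.
  by apply: Rdiv_le_0_compat => //; rewrite e; nra.
have [_ hs] := ln_step (ltn0Sn n).
have e2 : 2 - (ln (INR n.+1) + 2) / INR n.+1 + ln (INR n.+2) / (INR n.+2 * (INR n.+2 - 1))
  - (2 - (ln (INR n.+2) + 2) / INR n.+2) =
  ((INR n.+1 + 1) * (ln (INR n.+2) - ln (INR n.+1)) - 2) / (INR n.+1 * (INR n.+1 + 1)).
  by rewrite e; field; lra.
have : ((INR n.+1 + 1) * (ln (INR n.+2) - ln (INR n.+1)) - 2) / (INR n.+1 * (INR n.+1 + 1)) <= 0.
  apply/Rle_div_l; first nra.
  rewrite Rmult_0_l.
  have : (INR n.+1 + 1) * (ln (INR n.+2) - ln (INR n.+1)) <= (INR n.+1 + 1) * / INR n.+1.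
    by apply: Rmult_le_compat_l; lra.
  have : (INR n.+1 + 1) * / INR n.+1 <= 2.
    by apply/Rle_div_l; lra.
  lra.
lra.
Qed.

(** Lower half of Mertens' first theorem, from 1/(p-1) = 1/p + 1/(p(p-1)). The 3 is 1 from log n! >=
    n log n - n plus 2 from [lnp_tail]. *)
Lemma lnp_sum_ge n : (0 < n)%N -> ln (INR n) - 3 <= lnp_sum n.
Proof.
move=> n0; have h := INR_gt0 n0; have h1 := lnp_tail n0.
suff h2 : ln (INR n`!) <= INR n * (lnp_sum n +
    \sum_(1 <= p < n.+1 | prime p) ln (INR p) / (INR p * (INR p - 1))).
  have [h3 _] := ln_fact_bounds n0.
  apply: (Rmult_le_reg_l (INR n)) => //.
  have := Rmult_le_compat_l _ _ _ (Rlt_le _ _ h) h1; lra.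
rewrite fact_logn /lnp_sum -big_split big_distrr /=; apply: sum_le => p _ pp.
have [_ h2] := logn_fact_bounds pp n0; have := prime_ln_ge0 pp => h3.
have p1 := prime_INR_ge2 pp.
apply: Rle_trans (Rmult_le_compat_r _ _ _ h3 h2) _.
by right; field; lra.
Qed.

Lemma ln_ratio a b : 0 < a -> 0 < b -> (b - a) / b <= ln b - ln a.
Proof.
move=> ha hb; have := ln_le_sub1 (Rdiv_lt_0_compat _ _ ha hb).
rewrite ln_div //; have -> : a / b = 1 - (b - a) / b by field; lra.
lra.
Qed.

Lemma ln_INR_gt0 n : (1 < n)%N -> 0 < ln (INR n).
Proof. by move=> /ltn_INR h; rewrite -ln_1; apply: ln_increasing; rewrite /= in h; lra. Qed.

Lemma sum_inv_prime x y : (1 < x)%N -> (x <= y)%N ->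
  \sum_(x.+1 <= p < y.+1 | prime p) / INR p <=
  ln (ln (INR y)) - ln (ln (INR x)) + 5 / ln (INR x).
Proof.
move=> x1 xy; pose E n := lnp_sum n - ln (INR n).
have x0 : (0 < x)%N by exact: ltnW.
(* Abel summation: right-hand side minus left-hand side is nondecreasing in [y]. *)
suff h : \sum_(x.+1 <= p < y.+1 | prime p) / INR p <=
  ln (ln (INR y)) - ln (ln (INR x)) + (E y - ln 4) / ln (INR y) - (E x - ln 4) / ln (INR x).
  have lx := ln_INR_gt0 x1; have ly := ln_INR_gt0 (leq_trans x1 xy).
  have h1 : (E y - ln 4) / ln (INR y) <= 0.
    apply/Rle_div_l => //; rewrite Rmult_0_l /E.
    by have := @lnp_sum_le y (leq_trans x0 xy); lra.
  have h2 : - ((E x - ln 4) / ln (INR x)) <= 5 / ln (INR x).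
    have -> : - ((E x - ln 4) / ln (INR x)) = (ln 4 - E x) / ln (INR x) by field; lra.
    apply: Rmult_le_compat_r; first by left; apply: Rinv_0_lt_compat.
    by have := ln4_le2; have := lnp_sum_ge x0; rewrite /E; lra.
  lra.
rewrite -(subnKC xy); elim: (y - x)%N => [|k ih].
  by rewrite addn0 big_geq //; lra.
set n := (x + k)%N in ih *; rewrite addnS -/n.
rewrite sum_recr_from; last by rewrite ltnS leq_addr.
have n1 : (1 < n)%N by apply: leq_trans x1 _; exact: leq_addr.
clearbody n.
have ln1 := ln_INR_gt0 n1; have ln2 := ln_INR_gt0 (leqW n1).
have hE := lnp_sum_le (ltnW n1).
have hr := ln_ratio ln1 ln2.
have hA : (if prime n.+1 then / INR n.+1 else 0) =
  (lnp_sum n.+1 - lnp_sum n) / ln (INR n.+1).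
  rewrite /lnp_sum sum_recr; case: ifP => _; last by field; lra.
  by have := INR_gt0 (ltn0Sn n) => h; field; lra.
have hm : 0 <= (ln 4 - E n) * (/ ln (INR n) - / ln (INR n.+1)).
  apply: Rmult_le_pos; first by rewrite /E; lra.
  have : / ln (INR n.+1) <= / ln (INR n); last lra.
  by apply: Rinv_le_contravar => //; apply: ln_INR_le => //; exact: ltnW.
have e : (lnp_sum n.+1 - lnp_sum n) / ln (INR n.+1) =
  (ln (INR n.+1) - ln (INR n)) / ln (INR n.+1) + (E n.+1 - ln 4) / ln (INR n.+1)
   - (E n - ln 4) / ln (INR n) - (ln 4 - E n) * (/ ln (INR n) - / ln (INR n.+1)).
  by rewrite /E; field; split; exact: Rgt_not_eq.
rewrite hA e; lra.
Qed.

(** Logarithm of the product of (1 - 1/p)^(-1) over p <= n, the quantity in Mertens' third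
    theorem. *)
Definition neg_ln_euler n := \sum_(1 <= p < n.+1 | prime p) - ln (1 - / INR p).

(** Here -log(1 - 1/p) <= 1/(p-1), and the excess over 1/p telescopes over all integers beyond x to
    at most 1/x <= 1/log x. Bounding the growth from above is what turns information at infinity
    into a lower bound at x. *)
Lemma neg_ln_euler_step x y : (1 < x)%N -> (x <= y)%N ->
  neg_ln_euler y <= neg_ln_euler x + ln (ln (INR y)) - ln (ln (INR x)) + 6 / ln (INR x).
Proof.
move=> x1 xy; rewrite /neg_ln_euler (@big_cat_nat _ _ _ x.+1 1 y.+1) //=.
have x0 : (0 < x)%N by exact: ltnW.
have lx := ln_INR_gt0 x1.
suff : \sum_(x.+1 <= p < y.+1 | prime p) - ln (1 - / INR p) <=
  \sum_(x.+1 <= p < y.+1 | prime p) / INR p + 1 / ln (INR x).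
  have := sum_inv_prime x1 xy; rewrite /Rdiv; lra.
have h1 : \sum_(x.+1 <= p < y.+1) (/ (INR p - 1) - / INR p) <= 1 / ln (INR x).
  pose g k := - / (INR k - 1).
  apply: (Rle_trans _ (g y.+1 - g x.+1)).
    apply: sum_telescope_le; first by rewrite ltnS.
    move=> k /andP[k1 _]; have := INR_gt0 (leq_trans x0 (ltnW k1)).
    by rewrite /g S_INR => hk; right; rewrite (_ : INR k + 1 - 1 = INR k); ring.
  rewrite /g !S_INR.
  have e a : a + 1 - 1 = a by ring.
  rewrite !e.
  have hx := INR_gt0 x0; have := Rinv_0_lt_compat _ (INR_gt0 (leq_trans x0 xy)).
  have : / INR x <= / ln (INR x); last lra.
  by apply: Rinv_le_contravar => //; have := ln_le_sub1 hx; lra.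
apply: (Rle_trans _ (\sum_(x.+1 <= p < y.+1 | prime p) (/ INR p + (/ (INR p - 1) - / INR p)))).
  apply: sum_le => p _ /prime_INR_ge2 p2.
  have hp : 0 < 1 - / INR p.
    by have := Rinv_lt_contravar 1 (INR p); rewrite Rinv_1; lra.
  rewrite -ln_Rinv //; apply: Rle_trans (ln_le_sub1 (Rinv_0_lt_compat _ hp)) _.
  by right; field; lra.
rewrite big_split /=; apply: Rplus_le_compat_l; apply: Rle_trans h1.
rewrite big_mkcond /=; apply: sum_le => p; rewrite mem_index_iota => /andP[p1 _] _.
case: ifP => _; first lra.
have := ltn_INR p1; have := INR_ge1 x0; have := S_INR x => *.
have : / INR p <= / (INR p - 1); last lra.
by apply: Rinv_le_contravar; lra.
Qed.

(** * Euler products *)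

(** Products of the primes in [ps] with every exponent at most E. The cap makes the list finite, so
    a sum over it factors exactly into finite geometric sums. *)
Fixpoint smooth (E : nat) (ps : seq nat) : seq nat :=
  if ps is p :: ps' then [seq (p ^ e * m)%N | e <- iota 0 E.+1, m <- smooth E ps'] else [:: 1%N].

Lemma smooth_cons E p ps : smooth E (p :: ps) =
  [seq (p ^ e * m)%N | e <- iota 0 E.+1, m <- smooth E ps].
Proof. by []. Qed.

Arguments smooth : simpl never.

Lemma smooth_nil E : smooth E [::] = [:: 1%N].
Proof. by []. Qed.

Lemma smooth_gt0 E ps n : all prime ps -> n \in smooth E ps -> (0 < n)%N.
Proof.
elim: ps n => [|p ps ih] n /=; first by rewrite smooth_nil inE => _ /eqP ->.
case/andP=> pp hps; rewrite smooth_cons => /allpairsP[[e m] /= [_ hm ->]].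
by rewrite muln_gt0 expn_gt0 prime_gt0 // ih.
Qed.

Lemma smooth_primes E ps n q :
  all prime ps -> n \in smooth E ps -> prime q -> (q %| n)%N -> q \in ps.
Proof.
elim: ps n => [|p ps ih] n /=.
  by rewrite smooth_nil inE => _ /eqP ->; rewrite dvdn1 => qp /eqP h; rewrite h in qp.
case/andP=> pp hps; rewrite smooth_cons => /allpairsP[[e m] [_ /= hm ->]] qp.
rewrite Euclid_dvdM // => /orP[|/(ih _ hps hm qp)]; last by rewrite inE orbC => ->.
by rewrite Euclid_dvdX // dvdn_prime2 // => /andP[/eqP -> _]; rewrite mem_head.
Qed.

(** Unique factorization: the p-adic valuation recovers the exponent of the head prime, because no
    member of the tail list is divisible by it. *)
Lemma smooth_uniq E ps : all prime ps -> uniq ps -> uniq (smooth E ps).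
Proof.
elim: ps => [//|p ps ih] /= /andP[pp hps] /andP[pn ups]; rewrite smooth_cons.
apply: allpairs_uniq; [exact: iota_uniq|exact: ih|].
have lg m : m \in smooth E ps -> logn p m = 0%N.
  move=> hm; apply/eqP; rewrite -leqn0 leqNgt logn_gt0 mem_primes.
  apply/negP => /and3P[_ _ pm].
  by rewrite (smooth_primes hps hm pp pm) in pn.
move=> _ _ /allpairsP[[e m] [_ hm ->]] /allpairsP[[f n] [_ hn ->]] /= e1; rewrite /= in hm hn.
have m0 := smooth_gt0 hps hm; have n0 := smooth_gt0 hps hn.
have pe0 k : (0 < p ^ k)%N by rewrite expn_gt0 prime_gt0.
have := congr1 (logn p) e1; rewrite !lognM // !pfactorK // !lg // !addn0 => ef.
congr (_, _) => //; apply/eqP; rewrite -(eqn_pmul2l (pe0 e)) e1 ef //.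
Qed.

Lemma smooth_mem E ps n : all prime ps -> (0 < n)%N ->
  (forall q, prime q -> q %| n -> q \in ps)%N -> (forall q, logn q n <= E)%N ->
  n \in smooth E ps.
Proof.
elim: ps n => [|p ps ih] n /= hps n0 hq hE.
  rewrite smooth_nil inE; apply/eqP; case: n n0 hq hE => [//|[//|n]] _ /(_ (pdiv n.+2)).
  by rewrite pdiv_prime // pdiv_dvd => /(_ isT isT).
case/andP: hps => pp hps.
have [m mp nE] := pfactor_coprime pp n0.
have m0 : (0 < m)%N by move: n0; rewrite nE muln_gt0 => /andP[].
rewrite smooth_cons; apply/allpairsP; exists (logn p n, m); split; [|apply: ih => //|by rewrite mulnC].
- by rewrite mem_iota add0n ltnS hE.
- move=> q qp qm; have : q \in p :: ps by apply: hq => //; rewrite nE dvdn_mulr.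
  rewrite inE => /orP[/eqP qpE|//].
  by move: mp; rewrite -qpE prime_coprime // qm.
- move=> q; apply: leq_trans (hE q); apply: dvdn_leq_log => //.
  by rewrite [X in (_ %| X)%N]nE dvdn_mulr.
Qed.

Lemma smooth_le E ps x n : (0 < x)%N -> all (fun p => p <= x)%N ps -> n \in smooth E ps ->
  (n <= x ^ (E * size ps))%N.
Proof.
move=> x0; elim: ps n => [|p ps ih] n /=; first by rewrite smooth_nil inE muln0 => _ /eqP ->.
move=> /andP[px hps]; rewrite smooth_cons => /allpairsP[[e m] [he hm ->]]; rewrite /= mulnS expnD leq_mul ?ih //.
rewrite mem_iota add0n ltnS in he.
apply: (@leq_trans (x ^ e)); last by rewrite leq_pexp2l.
by elim: (e) => // k hk; rewrite !expnS leq_mul.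
Qed.

Definition mult_fun (g : nat -> R) :=
  g 1%N = 1 /\ forall m n, (0 < m)%N -> (0 < n)%N -> g (m * n)%N = g m * g n.

Lemma mult_fun_exp g p e : mult_fun g -> (0 < p)%N -> g (p ^ e)%N = g p ^ e.
Proof.
move=> [g1 gM] p0; elim: e => [|e ih] //=.
by rewrite expnS gM ?expn_gt0 ?p0 // ih.
Qed.

Lemma sum_smooth E ps g : all prime ps -> mult_fun g ->
  \sum_(n <- smooth E ps) g n = \prod_(p <- ps) \sum_(0 <= e < E.+1) g p ^ e.
Proof.
move=> hps hg; elim: ps hps => [|p ps ih] /=; first by rewrite smooth_nil big_seq1 big_nil; case: hg.
move=> /andP[pp hps]; rewrite big_cons -ih // smooth_cons big_allpairs_dep big_distrl /=.
rewrite /index_iota subn0; apply: eq_bigr => e _; rewrite big_distrr /= !big_seq.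
apply: eq_bigr => m hm; have m0 := smooth_gt0 hps hm.
case: (hg) => _ hM; rewrite hM //; last by rewrite expn_gt0 prime_gt0.
by rewrite (mult_fun_exp e hg (prime_gt0 pp)).
Qed.

Definition primes_upto n := [seq p <- iota 1 n | prime p].

Lemma primes_upto_prime n : all prime (primes_upto n).
Proof. exact: filter_all. Qed.

Lemma primes_upto_uniq n : uniq (primes_upto n).
Proof. by rewrite filter_uniq // iota_uniq. Qed.

Lemma mem_primes_upto n p : (p \in primes_upto n) = prime p && (p <= n)%N.
Proof.
rewrite mem_filter mem_iota; case: (boolP (prime p)) => //= pp.
by rewrite prime_gt0 // add1n ltnS.
Qed.

Lemma sum_primes_upto n (f : nat -> R) :
  \sum_(p <- primes_upto n) f p = \sum_(1 <= p < n.+1 | prime p) f p.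
Proof. by rewrite big_filter /index_iota subSS subn0. Qed.

Lemma geom_sum q n : (1 - q) * \sum_(0 <= e < n) q ^ e = 1 - q ^ n.
Proof.
elim: n => [|n ih]; first by rewrite big_geq //=; ring.
by rewrite big_nat_recr //= Rmult_plus_distr_l ih; ring.
Qed.

(** Every k <= n has prime factors and exponents at most n, so it occurs in the smooth list with cap
    n; the finite geometric sums are then completed to full Euler factors. *)
Lemma euler_product_ge n g : mult_fun g ->
  (forall k, (0 < k)%N -> 0 <= g k) -> (forall p, prime p -> g p < 1) ->
  \sum_(1 <= k < n.+1) g k <= \prod_(p <- primes_upto n) / (1 - g p).
Proof.
move=> hg g0 g1.
apply: (Rle_trans _ (\sum_(k <- smooth n (primes_upto n)) g k)).
  apply: sum_subset; first exact: iota_uniq.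
  - move=> k; rewrite mem_index_iota ltnS => /andP[k0 kn].
    apply: smooth_mem => //; first exact: primes_upto_prime.
    + by move=> q qp qk; rewrite mem_primes_upto qp (leq_trans (dvdn_leq k0 qk)).
    + by move=> q; apply: leq_trans kn; apply: ltnW; exact: ltn_logl.
  - move=> k hk; apply: g0; exact: smooth_gt0 (primes_upto_prime n) hk.
rewrite sum_smooth ?primes_upto_prime //.
apply: (proj2 (prod_le _)) => p; rewrite mem_primes_upto => /andP[pp _] _.
have h0 := g0 _ (prime_gt0 pp); have h1 := g1 _ pp; have hs := geom_sum (g p) n.+1.
split; first by apply: sum_ge0 => e _ _; apply: pow_le.
apply: (Rmult_le_reg_l (1 - g p)); first lra.
rewrite hs Rinv_r; last lra.
have := pow_le _ n.+1 h0; lra.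
Qed.

(** At most x primes, each at most x and with exponent at most E, give products at most x^(E x), so
    the whole smooth list fits below N. *)
Lemma sum_ge_euler_product N x E g : mult_fun g ->
  (forall k, 0 <= g k) -> (0 < x)%N -> (x ^ (E * x) <= N)%N ->
  \prod_(p <- primes_upto x) \sum_(0 <= e < E.+1) g p ^ e <=
  \sum_(1 <= k < N.+1 | k \in smooth E (primes_upto x)) g k.
Proof.
move=> hg g0 x0 hN; rewrite -sum_smooth ?primes_upto_prime // -[X in _ <= X]big_filter.
apply: sum_subset; first exact: smooth_uniq (primes_upto_prime x) (primes_upto_uniq x).
  move=> k hk; rewrite mem_filter hk mem_index_iota ltnS.
  rewrite (smooth_gt0 (primes_upto_prime x) hk) /=; apply: leq_trans hN.
  apply: (leq_trans (smooth_le x0 _ hk)).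
    by apply/allP => p; rewrite mem_primes_upto => /andP[].
  rewrite leq_pexp2l // leq_mul // size_filter.
  by apply: (leq_trans (count_size _ _)); rewrite size_iota.
by move=> k _.
Qed.

(** * The constant in Mertens' third theorem *)

Lemma sum_f_R0_shift (g : nat -> R) N :
  sum_f_R0 (fun k => g (k + 1)%coq_nat) N = \sum_(1 <= n < N.+2) g n.
Proof.
elim: N => [|N ih] /=; first by rewrite big_nat1.
by rewrite ih [in RHS]big_nat_recr //= Nat.add_1_r.
Qed.

Definition harm n := \sum_(1 <= k < n.+1) / INR k.

Lemma harmS n : harm n.+1 = harm n + / INR n.+1.
Proof. by rewrite /harm big_nat_recr. Qed.

Lemma ln_le_harm n : ln (INR n.+1) <= harm n.
Proof.
elim: n => [|n ih]; first by rewrite ln_1 /harm big_geq //; lra.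
rewrite harmS; have [_ h] := ln_step (ltn0Sn n); lra.
Qed.

(** The sequence H_n - log n decreases and is bounded below, so each term dominates its limit. *)
Lemma euler_gamma_le n : (0 < n)%N -> euler_gamma <= harm n - ln (INR n).
Proof.
case: n => // n _; rewrite /euler_gamma.
pose u N := harm N.+1 - ln (INR N.+1).
rewrite (Lim_seq_ext _ u); last first.
  by move=> N; rewrite (sum_f_R0_shift (fun k => / INR k)) Nat.add_1_r.
have hdec N : u N.+1 <= u N.
  rewrite /u (harmS N.+1); have [h _] := ln_step (ltn0Sn N); lra.
have hlim : is_lim_seq u (real (Lim_seq u)).
  apply: Lim_seq_correct'; apply: (ex_finite_lim_seq_decr u 0) => // N.
  rewrite /u; have := ln_le_harm N; rewrite harmS.
  have := Rinv_0_lt_compat _ (INR_gt0 (ltn0Sn N)); lra.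
exact: (is_lim_seq_decr_compare u _ hlim hdec n).
Qed.

Lemma bernoulli n h : 0 <= h <= 1 -> 1 - INR n * h <= (1 - h) ^ n.
Proof.
move=> hh; elim: n => [|n ih]; first by rewrite /=; lra.
rewrite S_INR /=; have := pos_INR n; have := pow_le (1 - h) n; nra.
Qed.

Lemma exp_mono x y : x <= y -> exp x <= exp y.
Proof. by case=> [/exp_increasing|->]; lra. Qed.

(** The power n^(-s). *)
Definition pw s n := exp (- (s * ln (INR n))).

Lemma pw_gt0 s n : 0 < pw s n.
Proof. exact: exp_pos. Qed.

Lemma pw_le s m n : 0 <= s -> (0 < m)%N -> (m <= n)%N -> pw s n <= pw s m.
Proof.
move=> s0 m0 mn; apply: exp_mono; apply: Ropp_le_contravar.
by apply: Rmult_le_compat_l => //; exact: ln_INR_le.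
Qed.

Lemma pw_mult_fun s : mult_fun (pw s).
Proof.
split; first by rewrite /pw ln_1 Rmult_0_r Ropp_0 exp_0.
move=> m n /INR_gt0 m0 /INR_gt0 n0; rewrite /pw INR_muln ln_mult // -exp_plus.
by congr exp; ring.
Qed.

Lemma pw_succ s n : (0 < n)%N -> pw (1 + s) n = pw s n / INR n.
Proof.
move=> n0; have h := INR_gt0 n0.
rewrite /pw Rmult_plus_distr_r Ropp_plus_distr exp_plus Rmult_1_l exp_Ropp exp_ln //.
by rewrite Rmult_comm.
Qed.

(** The left side is the integral of u^(-1-s) over [1, N+1]. The comparison is done one step at a
    time with 1 + y <= e^y, without integration. *)
Lemma pw_sum_ge s N : 0 < s -> (1 - pw s N.+1) / s <= \sum_(1 <= k < N.+1) pw (1 + s) k.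
Proof.
move=> s0; elim: N => [|N ih].
  by rewrite big_geq // (proj1 (pw_mult_fun s)) Rminus_diag /Rdiv Rmult_0_l; lra.
rewrite big_nat_recr //=; apply: (Rle_trans _ ((1 - pw s N.+1) / s + pw (1 + s) N.+1)); last lra.
rewrite pw_succ //; have hN := INR_gt0 (ltn0Sn N).
have : pw s N.+1 * (1 - s / INR N.+1) <= pw s N.+2.
  apply: (Rle_trans _ (pw s N.+1 * exp (- (s * (ln (INR N.+2) - ln (INR N.+1)))))).
    apply: Rmult_le_compat_l; first exact: Rlt_le (pw_gt0 _ _).
    have := exp_ineq1_le (- (s * (ln (INR N.+2) - ln (INR N.+1)))).
    have [_ h] := ln_step (ltn0Sn N).
    have := Rmult_le_compat_l s _ _ (Rlt_le _ _ s0) h; rewrite /Rdiv; lra.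
  by rewrite /pw -exp_plus; right; congr exp; ring.
move=> h; apply: (Rmult_le_reg_l s) => //.
have -> : s * ((1 - pw s N.+2) / s) = 1 - pw s N.+2 by field; lra.
have -> : s * ((1 - pw s N.+1) / s + pw s N.+1 / INR N.+1) =
  1 - pw s N.+1 * (1 - s / INR N.+1) by field; lra.
lra.
Qed.

(* The convexity inequality [(1 - u)^s <= 1 - s u] in logarithmic form. *)
Lemma ln_one_minus_scale s u : 0 <= s <= 1 -> 0 <= u < 1 ->
  - ln (1 - s * u) <= s * - ln (1 - u).
Proof.
move=> hs hu; set a := ln (1 - u).
have ea : exp a = 1 - u by rewrite exp_ln; lra.
suff h : exp (s * a) <= 1 - s * u.
  have := ln_le _ _ (exp_pos _) h; rewrite ln_exp; lra.
have tangent y : exp (s * a) * (1 + (y - s * a)) <= exp y.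
  have -> : exp y = exp (s * a) * exp (y - s * a) by rewrite -exp_plus; congr exp; ring.
  by apply: Rmult_le_compat_l; [exact: Rlt_le (exp_pos _)|exact: exp_ineq1_le].
have h1 := Rmult_le_compat_l s _ _ (proj1 hs) (tangent a).
have s1 : 0 <= 1 - s by lra.
have h2 := Rmult_le_compat_l _ _ _ s1 (tangent 0).
rewrite ea in h1; rewrite exp_0 in h2.
by ring_simplify in h1; ring_simplify in h2; lra.
Qed.

Lemma inv_prime p : prime p -> 0 < / INR p <= / 2.
Proof.
move=> /prime_INR_ge2 h; split; first by apply: Rinv_0_lt_compat; lra.
by apply: Rinv_le_contravar; lra.
Qed.

Lemma neg_ln_euler_term_ge0 p : prime p -> 0 <= - ln (1 - / INR p).
Proof. by move=> /inv_prime h; have := @ln_le_sub1 (1 - / INR p); lra. Qed.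

(** The truncated sum for zeta(1+s) is at most its Euler product, and convexity turns -log(1 -
    p^(-1-s)) into p^(-s) times -log(1 - 1/p). The right side is thus a Laplace transform of the
    Mertens sum. *)
Lemma ln_zeta_le s N : 0 < s <= 1 -> (0 < N)%N ->
  ln ((1 - pw s N.+1) / s) <= \sum_(1 <= p < N.+1 | prime p) pw s p * - ln (1 - / INR p).
Proof.
move=> hs N0.
have s0 : 0 < s by lra.
have pw1 n : (0 < n)%N -> pw s n <= 1.
  by move=> n0; rewrite -(proj1 (pw_mult_fun s)); apply: pw_le => //; lra.
have pwp p : prime p -> pw (1 + s) p = pw s p * / INR p.
  by move=> pp; rewrite pw_succ // prime_gt0.
have lt1 p : prime p -> pw (1 + s) p < 1.
  move=> pp; rewrite pwp //; have := inv_prime pp; have := pw_gt0 s p.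
  have := pw1 p (prime_gt0 pp); nra.
have pos : 0 < (1 - pw s N.+1) / s.
  apply: Rdiv_lt_0_compat => //.
  have : pw s N.+1 < 1; last lra.
  rewrite -exp_0; apply: exp_increasing.
  by have := Rmult_lt_0_compat _ _ s0 (@ln_INR_gt0 N.+1 N0); lra.
have h := euler_product_ge N (pw_mult_fun (1 + s)) (fun k _ => Rlt_le _ _ (pw_gt0 (1 + s) k)) lt1.
apply: Rle_trans (ln_le _ _ pos (Rle_trans _ _ _ (pw_sum_ge N s0) h)) _.
rewrite ln_prod; last first.
  move=> p; rewrite mem_primes_upto => /andP[/lt1 hp _] _.
  by apply: Rinv_0_lt_compat; lra.
rewrite -sum_primes_upto; apply: sum_le => p; rewrite mem_primes_upto => /andP[pp _] _.
have hp := lt1 _ pp; have hi := inv_prime pp.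
rewrite ln_Rinv ?pwp //; last by rewrite -pwp //; lra.
apply: ln_one_minus_scale; last lra.
by have := pw_gt0 s p; have := pw1 p (prime_gt0 pp); lra.
Qed.

Lemma pw_pow2 s m : pw s (2 ^ m) = exp (- (s * ln 2)) ^ m.
Proof. exact: (mult_fun_exp m (pw_mult_fun s)). Qed.

(** On the block 2^m < p <= 2^(m+1) one has p^(-s) <= q^m with q = 2^(-s). The prime sum becomes a
    power series in q, to be compared with that of the harmonic increments 1/(m+1). *)
Lemma dyadic_blocks s M : 0 <= s ->
  \sum_(1 <= p < (2 ^ M).+1 | prime p) pw s p * - ln (1 - / INR p) <=
  \sum_(0 <= m < M) exp (- (s * ln 2)) ^ m *
    (neg_ln_euler (2 ^ m.+1) - neg_ln_euler (2 ^ m)).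
Proof.
move=> s0; elim: M => [|M ih].
  by rewrite expn0 big_mkcond big_nat1 /= big_geq //; lra.
have h2 : (2 ^ M <= 2 ^ M.+1)%N by rewrite leq_pexp2l.
rewrite [X in _ <= X]big_nat_recr // (@big_cat_nat _ _ _ (2 ^ M).+1 1 (2 ^ M.+1).+1) //=.
apply: Rplus_le_compat => //.
rewrite /neg_ln_euler (@big_cat_nat _ _ _ (2 ^ M).+1 1 (2 ^ M.+1).+1) //=.
have -> a b : a + b - a = b by ring.
rewrite big_distrr /=; apply: sum_le => p; rewrite mem_index_iota => /andP[p1 p2] pp.
apply: Rmult_le_compat_r; first exact: neg_ln_euler_term_ge0.
by rewrite -pw_pow2; apply: pw_le; rewrite ?expn_gt0 // ltnW.
Qed.

(** The difference of the two sides vanishes at 0, and its derivative 1/(1-x) minus a partial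
    geometric series is nonnegative. *)
Lemma ln_series_le q M : 0 < q < 1 ->
  q * \sum_(0 <= m < M) q ^ m / INR m.+1 <= - ln (1 - q).
Proof.
move=> hq.
pose f x := - ln (1 - x) - x * \sum_(0 <= m < M) x ^ m / INR m.+1.
pose df x := / (1 - x) - \sum_(0 <= m < M) x ^ m.
have hd x : x < 1 -> is_derive f x (df x).
  move=> hx; apply: is_derive_minus; first by auto_derive; [lra|field; lra].
  elim: M {f df} => [|M ih].
    apply: (is_derive_ext (fun _ => 0)); first by move=> t; rewrite big_geq // Rmult_0_r.
    by rewrite big_geq //; exact: is_derive_const.
  apply: (is_derive_ext (fun t => t * (\sum_(0 <= m < M) t ^ m / INR m.+1) + t ^ M.+1 / INR M.+1)).
    by move=> t; rewrite big_nat_recr //=; rewrite /Rdiv; ring.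
  rewrite big_nat_recr //; apply: is_derive_plus; first exact: ih.
  have hM : INR M.+1 <> 0 by apply: not_0_INR.
  by auto_derive => //; field.
have [c [e hc]] := MVT_cor2 f df 0 q (proj1 hq)
  (fun c hc => proj1 (is_derive_Reals _ _ _) (hd c (Rle_lt_trans _ _ _ (proj2 hc) (proj2 hq)))).
have f0 : f 0 = 0 by rewrite /f Rmult_0_l Rminus_0_r Rminus_0_r ln_1 Ropp_0.
have : 0 <= df c.
  have h := geom_sum c M; have hc1 : 0 < 1 - c by lra.
  apply: (Rmult_le_reg_l (1 - c)) => //.
  rewrite /df Rmult_minus_distr_l h Rinv_r; last lra.
  by have := pow_le c M; lra.
move=> hdf; have : f q = df c * (q - 0) by lra.
have : 0 <= df c * (q - 0) by apply: Rmult_le_pos; lra.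
rewrite /f; lra.
Qed.

(** Summation by parts against the decreasing weights q^m: replacing b by a majorant a costs only
    the boundary term at m0. The induction keeps the boundary term at M, which is nonnegative and
    dropped at the end. *)
Lemma abel_le q M m0 (a b : nat -> R) : 0 < q < 1 -> (m0 <= M)%N ->
  (forall m, (m0 <= m)%N -> b m <= a m) ->
  \sum_(m0 <= m < M) q ^ m * (b m.+1 - b m) <=
  \sum_(m0 <= m < M) q ^ m * (a m.+1 - a m) + q ^ m0 * (a m0 - b m0).
Proof.
move=> hq hM hab.
suff : \sum_(m0 <= m < M) q ^ m * (b m.+1 - b m) + q ^ M * (a M - b M) <=
  \sum_(m0 <= m < M) q ^ m * (a m.+1 - a m) + q ^ m0 * (a m0 - b m0).
  have := hab _ hM; have : 0 < q ^ M by apply: pow_lt; lra.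
  move=> h1 h2; have : 0 <= q ^ M * (a M - b M) by apply: Rmult_le_pos; lra.
  lra.
elim: M hM => [|M ih]; first by rewrite leqn0 => /eqP ->; rewrite !big_geq //; lra.
rewrite leq_eqVlt => /orP[/eqP <-|]; first by rewrite !big_geq //; lra.
rewrite ltnS => hM; rewrite !big_nat_recr //=; have := ih hM.
have := hab M.+1 (leqW hM); have hp : 0 < q ^ M by apply: pow_lt; lra.
move=> h1; have : 0 <= (1 - q) * (q ^ M * (a M.+1 - b M.+1)).
  by apply: Rmult_le_pos; [lra|apply: Rmult_le_pos; lra].
lra.
Qed.

Lemma neg_ln_euler_ge0 n : 0 <= neg_ln_euler n.
Proof. by apply: sum_ge0 => p _; exact: neg_ln_euler_term_ge0. Qed.

Lemma neg_ln_euler_le m n : (m <= n)%N -> neg_ln_euler m <= neg_ln_euler n.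
Proof.
move=> mn; rewrite /neg_ln_euler (@big_cat_nat _ _ _ m.+1 1 n.+1) //=.
have : 0 <= \sum_(m.+1 <= p < n.+1 | prime p) - ln (1 - / INR p); last lra.
by apply: sum_ge0 => p _; exact: neg_ln_euler_term_ge0.
Qed.

Lemma sum_cat_nat (m n p : nat) (F : nat -> R) : (m <= n)%N -> (n <= p)%N ->
  \sum_(m <= i < p) F i = \sum_(m <= i < n) F i + \sum_(n <= i < p) F i.
Proof. exact: big_cat_nat. Qed.

Lemma ln2_gt0 : 0 < ln 2.
Proof. by rewrite -ln_1; apply: ln_increasing; lra. Qed.

Lemma ln_pow2 m : ln (INR (2 ^ m)) = INR m * ln 2.
Proof. by rewrite INR_expn ln_pow //=; lra. Qed.

Lemma ln_one_minus_ge u : 0 <= u <= / 2 -> - (2 * u) <= ln (1 - u).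
Proof.
move=> hu; have hp : 0 < 1 - u by lra.
have := ln_le_sub1 (Rinv_0_lt_compat _ hp); rewrite ln_Rinv //.
have -> : / (1 - u) - 1 = u / (1 - u) by field; lra.
have : u / (1 - u) <= 2 * u by apply/Rle_div_l => //; nra.
lra.
Qed.

Lemma pow_lt1 q n : 0 < q < 1 -> (0 < n)%N -> 0 < q ^ n < 1.
Proof.
move=> hq /ltP n0; split; first by apply: pow_lt; lra.
by apply: (proj2 (pow_lt_1_compat q n _ n0)); lra.
Qed.

(** For q = 2^(-s) the left side is log(1/s), which [ln_zeta_le] reaches as the truncation tends to
    infinity. On the right stand the transform of the harmonic sums, the shift D, and the
    contribution of the blocks below m0, where nothing is assumed. *)
Lemma laplace_compare m0 D q :
  (forall m, (m0 <= m)%N -> (0 < m)%N -> neg_ln_euler (2 ^ m) <= harm m + D) ->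
  (0 < m0)%N -> / 2 <= q < 1 ->
  ln (- (ln 2 / ln q)) <=
  - ln (1 - q) / q + D * q ^ m0 + neg_ln_euler (2 ^ m0) * (1 - q ^ m0).
Proof.
move=> hD m00 hq; have q0 : 0 < q < 1 by lra.
have l2 := ln2_gt0.
have lq : ln q < 0 by rewrite -ln_1; apply: ln_increasing; lra.
have lq2 : - ln 2 <= ln q by rewrite -ln_Rinv; [apply: ln_le; lra|lra].
set s := - ln q / ln 2.
have hs : 0 < s <= 1.
  split; first by apply: Rdiv_lt_0_compat; lra.
  by apply/Rle_div_l; lra.
have es : exp (- (s * ln 2)) = q.
  by rewrite (_ : - (s * ln 2) = ln q) ?exp_ln //; [lra|rewrite /s; field; lra].
have -> : - (ln 2 / ln q) = / s by rewrite /s; field; lra.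
set rhs := (X in _ <= X).
have step M : (m0 <= M)%N -> ln ((1 - q ^ M) / s) <= rhs.
  move=> hM; have hM0 := leq_trans m00 hM.
  have qM : 0 < q ^ M < 1 by exact: pow_lt1.
  have qm : 0 < q ^ m0 < 1 by exact: pow_lt1.
  have h1 := @ln_zeta_le s (2 ^ M) hs; have {}h1 : ln ((1 - pw s (2 ^ M).+1) / s) <= \sum_(1 <= p < (2 ^ M).+1 | prime p) pw s p * - ln (1 - / INR p) by apply: h1; rewrite expn_gt0.
  have h2 := @dyadic_blocks s M (Rlt_le _ _ (proj1 hs)); rewrite es in h2.
  have h3 : ln ((1 - q ^ M) / s) <= ln ((1 - pw s (2 ^ M).+1) / s).
    apply: ln_le; first by apply: Rdiv_lt_0_compat; lra.
    apply: Rmult_le_compat_r; first by left; apply: Rinv_0_lt_compat; lra.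
    have : pw s (2 ^ M).+1 <= q ^ M; last lra.
    by rewrite -es -pw_pow2; apply: pw_le; rewrite ?expn_gt0 //; lra.
  apply: Rle_trans h3 (Rle_trans _ _ _ h1 (Rle_trans _ _ _ h2 _)) => {h1 h2}.
  rewrite (@sum_cat_nat 0 m0 M) //.
  have h4 : \sum_(0 <= m < m0) q ^ m * (neg_ln_euler (2 ^ m.+1) - neg_ln_euler (2 ^ m)) <=
      neg_ln_euler (2 ^ m0).
    apply: (Rle_trans _ (neg_ln_euler (2 ^ m0) - neg_ln_euler (2 ^ 0))); last first.
      by have := neg_ln_euler_ge0 (2 ^ 0); lra.
    apply: (sum_telescope_le (g := fun m => neg_ln_euler (2 ^ m))) => // k _.
    have hk : neg_ln_euler (2 ^ k) <= neg_ln_euler (2 ^ k.+1).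
      by apply: neg_ln_euler_le; rewrite leq_pexp2l.
    have : 0 <= (1 - q ^ k) * (neg_ln_euler (2 ^ k.+1) - neg_ln_euler (2 ^ k)).
      apply: Rmult_le_pos; last lra.
      by have := pow_incr q 1 k; rewrite pow1; lra.
    lra.
  have h5 := @abel_le q M m0 (fun m => harm m + D) (fun m => neg_ln_euler (2 ^ m)) q0 hM
    (fun m hm => hD m hm (leq_trans m00 hm)).
  have h6 : \sum_(m0 <= m < M) q ^ m * (harm m.+1 + D - (harm m + D)) =
      \sum_(m0 <= m < M) q ^ m / INR m.+1.
    by apply: eq_bigr => m _; rewrite harmS /Rdiv; ring.
  rewrite {}h6 in h5; cbv beta in h5.
  have h7 := @ln_series_le q M q0.
  (* The boundary term left by Abel summation is absorbed by the first m0 terms of the logarithmic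
     series. *)
  have h8 : q ^ m0 * harm m0 <= \sum_(0 <= m < m0) q ^ m / INR m.+1.
    rewrite /harm big_add1 /= big_distrr /=; apply: sum_le => m; rewrite mem_index_iota => /= hm _.
    apply: Rmult_le_compat_r; first by left; apply: Rinv_0_lt_compat; exact: (INR_gt0 (ltn0Sn m)).
    rewrite -(subnKC (ltnW hm)) pow_add -{2}(Rmult_1_r (q ^ m)).
    apply: Rmult_le_compat_l; first by apply: pow_le; lra.
    by have := pow_incr q 1 (m0 - m); rewrite pow1; lra.
  have h9 : \sum_(0 <= m < M) q ^ m / INR m.+1 <= - ln (1 - q) / q.
    by apply/Rle_div_r; lra.
  rewrite (@sum_cat_nat 0 m0 M) // in h9.
  rewrite /rhs; lra.
apply: le_epsilon => eps he.
(* Once q^M < e, the truncation costs -log(1 - q^M) <= 2 q^M <= eps; the cap 1/2 is what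
   [ln_one_minus_ge] asks for. *)
pose e := Rmin (/ 2) (eps / 2).
have e0 : 0 < e by apply: Rmin_pos; lra.
have [|N hN] := pow_lt_1_zero q _ e e0; first by rewrite Rabs_pos_eq; lra.
pose M := maxn m0 N.
have := step M (leq_maxl _ _).
have hM : 0 < q ^ M by apply: pow_lt; lra.
have : q ^ M < e.
  by have := hN M; rewrite Rabs_pos_eq; [apply; apply/leP; exact: leq_maxr|lra].
have := Rmin_l (/ 2) (eps / 2); have := Rmin_r (/ 2) (eps / 2); rewrite -/e => e1 e2 e3.
rewrite /Rdiv ln_mult; [|lra|by apply: Rinv_0_lt_compat; lra].
have := @ln_one_minus_ge (q ^ M); lra.
Qed.

(* As [q -> 1], both Laplace transforms are asymptotic to [- ln (1 - q)], which leaves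
   [0 <= D - ln (ln 2)]. *)
Lemma mertens_constant m0 D :
  (forall m, (m0 <= m)%N -> (0 < m)%N -> neg_ln_euler (2 ^ m) <= harm m + D) ->
  (0 < m0)%N -> ln (ln 2) <= D.
Proof.
move=> hD m00; set b := neg_ln_euler (2 ^ m0).
have l2 := ln2_gt0.
have key eta : 0 < eta <= / 2 -> ln (ln 2) <= D + eta * (6 + Rabs (b - D) * INR m0).
  (* With 1 - q = eta^2 the crude bound -log(1 - q) <= 2/eta suffices: multiplied by 1/q - 1 <= 2
     eta^2 it is O(eta), like all the other errors. *)
  move=> heta; have [q qE] : exists q, q = 1 - eta ^ 2 by eexists.
  have hq : 3 / 4 <= q < 1 by rewrite qE; nra.
  have := @laplace_compare m0 D q hD m00; have hq2 : / 2 <= q < 1 by lra.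
  move=> /(_ hq2); rewrite -/b.
  have lq : ln q < 0 by rewrite -ln_1; apply: ln_increasing; lra.
  have lqi : - ln q <= / q - 1.
    by rewrite -ln_Rinv; [apply: ln_le_sub1; apply: Rinv_0_lt_compat; lra|lra].
  have qi : / q - 1 <= 2 * eta ^ 2.
    have -> : / q - 1 = eta ^ 2 / q by rewrite (_ : eta ^ 2 = 1 - q); [field|]; lra.
    by apply/Rle_div_l; nra.
  have lnlnq : ln (- ln q) <= ln (1 - q) - ln q.
    rewrite -ln_div; [|lra|lra]; apply: ln_le; first lra.
    apply: Rle_trans lqi _; right; field; lra.
  have -> : - (ln 2 / ln q) = ln 2 / - ln q by field; lra.
  rewrite ln_div; [|lra|lra].
  have l1 : - ln (1 - q) <= 2 / eta.
    have -> : 1 - q = eta ^ 2 by lra.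
    rewrite ln_pow; last lra.
    have he : 0 < / eta by apply: Rinv_0_lt_compat; lra.
    have := ln_le_sub1 he; rewrite ln_Rinv; last lra.
    rewrite /= /Rdiv; lra.
  have l3 : - ln (1 - q) / q <= - ln (1 - q) + 4 * eta.
    have -> : - ln (1 - q) / q = - ln (1 - q) + - ln (1 - q) * (/ q - 1) by field; lra.
    apply: Rplus_le_compat_l.
    apply: (Rle_trans _ (2 / eta * (2 * eta ^ 2))); last by right; field; lra.
    apply: Rmult_le_compat => //.
      have : ln (1 - q) <= 0; last lra.
      by rewrite -ln_1; apply: ln_le; lra.
    have : 1 <= / q by rewrite -{1}Rinv_1; apply: Rinv_le_contravar; lra.
    lra.
  have hb : 1 - q ^ m0 <= INR m0 * eta.
    have he2 : 0 <= eta ^ 2 <= eta by nra.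
    have := @bernoulli m0 (eta ^ 2); rewrite -qE.
    have := Rmult_le_compat_l _ _ _ (pos_INR m0) (proj2 he2); lra.
  have hb2 : 0 <= 1 - q ^ m0 by have := pow_incr q 1 m0; rewrite pow1; lra.
  have hb3 : (b - D) * (1 - q ^ m0) <= Rabs (b - D) * (INR m0 * eta).
    apply: (Rle_trans _ (Rabs (b - D) * (1 - q ^ m0))).
      by apply: Rmult_le_compat_r => //; exact: Rle_abs.
    by apply: Rmult_le_compat_l => //; exact: Rabs_pos.
  have : eta ^ 2 <= eta / 2 by nra.
  lra.
apply: le_epsilon => eps he.
set K := 6 + Rabs (b - D) * INR m0 in key.
have hK : 6 <= K.
  by have := Rmult_le_pos _ _ (Rabs_pos (b - D)) (pos_INR m0); rewrite /K; lra.
pose eta := Rmin (/ 2) (eps / K).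
have eK : 0 < eps / K by apply: Rdiv_lt_0_compat; lra.
have e0 : 0 < eta by apply: Rmin_pos; lra.
have := Rmin_l (/ 2) (eps / K); have := Rmin_r (/ 2) (eps / K); rewrite -/eta => e1 e2.
apply: Rle_trans (key eta _) _; first lra.
have : eta * K <= eps by apply/Rle_div_r; lra.
lra.
Qed.

(** D is the deficit at x carried forward: [neg_ln_euler_step] from x to 2^m, together with log m <=
    H_m - gamma, gives the hypothesis of [mertens_constant], whose conclusion is the bound claimed.
    Taking m0 = x ensures 2^m >= x. *)
Lemma mertens_lower x : (1 < x)%N ->
  ln (ln (INR x)) + euler_gamma - 6 / ln (INR x) <= neg_ln_euler x.
Proof.
move=> x1; have lx := ln_INR_gt0 x1; have l2 := ln2_gt0.
pose D := neg_ln_euler x - ln (ln (INR x)) + 6 / ln (INR x) + ln (ln 2) - euler_gamma.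
suff : ln (ln 2) <= D by rewrite /D; lra.
apply: (@mertens_constant x D); last exact: ltnW.
move=> m xm m0; have x2 : (x <= 2 ^ m)%N.
  by apply: leq_trans xm _; apply: ltnW; exact: ltn_expl.
have h1 := neg_ln_euler_step x1 x2; rewrite ln_pow2 in h1.
have hm := INR_gt0 m0.
rewrite (ln_mult (INR m)) // in h1.
have := euler_gamma_le m0; rewrite /D; lra.
Qed.

(** * The size of the resonator *)

(** Partial summation: passing from x to x+1 adds (log(x+1) - log x) theta(x) <= theta(x)/x <= log
    4, and the new prime has weight zero. *)
Lemma lnp_ln_quot_le x :
  \sum_(1 <= p < x.+1 | prime p) ln (INR p) * (ln (INR x) - ln (INR p)) <= INR x * ln 4.
Proof.
elim: x => [|x ih]; first by rewrite big_geq //= Rmult_0_l; lra.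
case: x ih => [_|x ih].
  rewrite sum_recr big_geq //= Rmult_1_l Rplus_0_l.
  by rewrite -ln_1; apply: ln_le; lra.
rewrite sum_recr Rminus_diag Rmult_0_r if_same Rplus_0_r.
have -> : \sum_(1 <= p < x.+2 | prime p) ln (INR p) * (ln (INR x.+2) - ln (INR p)) =
  \sum_(1 <= p < x.+2 | prime p) ln (INR p) * (ln (INR x.+1) - ln (INR p)) +
  (ln (INR x.+2) - ln (INR x.+1)) * theta x.+1.
  by rewrite /theta big_distrr -big_split; apply: eq_bigr => p _ /=; ring.
have [h1 h2] := ln_step (ltn0Sn x); have h3 := theta_le x.+1.
have hx := INR_gt0 (ltn0Sn x).
have h4 : (ln (INR x.+2) - ln (INR x.+1)) * theta x.+1 <= / INR x.+1 * (INR x.+1 * ln 4).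
  apply: Rmult_le_compat => //.
    by have := Rinv_0_lt_compat _ (INR_gt0 (ltn0Sn x.+1)); lra.
  by apply: sum_ge0 => p _; exact: prime_ln_ge0.
have e : / INR x.+1 * (INR x.+1 * ln 4) = ln 4 by field; lra.
have e2 : INR x.+2 = INR x.+1 + 1 by exact: S_INR.
rewrite e2 in ih h4 *; lra.
Qed.

(** The minimum carries the induction: when n+1 is counted, n+1 <= sqrt y, so the trivial bound n+1
    already respects both entries. *)
Lemma count_below_sqrt y n : 0 <= y ->
  \sum_(1 <= p < n.+1) (if Rlt_dec (INR p * INR p) y then 1 else 0) <= Rmin (INR n) (sqrt y).
Proof.
move=> y0; elim: n => [|n ih].
  by rewrite big_geq // Rmin_left /=; [lra|exact: sqrt_pos].
rewrite sum_nat_recr //.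
have := S_INR n; have := Rmin_l (INR n) (sqrt y); have := Rmin_r (INR n) (sqrt y) => h1 h2 h3.
case: Rlt_dec => h; cbn [is_left]; last by apply: Rmin_glb; lra.
have : INR n.+1 <= sqrt y.
  rewrite -(sqrt_square (INR n.+1)); last exact: pos_INR.
  by apply: sqrt_le_1_alt; lra.
by move=> h4; apply: Rmin_glb; lra.
Qed.

Lemma ln_mult_ln_le x : 1 <= x -> ln x * (1 + ln x) <= 16 * sqrt x.
Proof.
move=> x1; set y := sqrt (sqrt x).
have s0 := sqrt_lt_R0 x ltac:(lra).
have y0 : 0 < y by exact: sqrt_lt_R0.
have ey : y * y = sqrt x by apply: sqrt_sqrt; lra.
have ex : x = y ^ 4.
  rewrite -(sqrt_sqrt x); last lra.
  by rewrite -ey; ring.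
have hl : 0 <= ln x <= 4 * (y - 1).
  split; first by rewrite -ln_1; apply: ln_le; lra.
  by rewrite {1}ex ln_pow //; have := ln_le_sub1 y0; rewrite /=; lra.
have : ln x * (1 + ln x) <= (4 * y) * (4 * y) by apply: Rmult_le_compat; lra.
lra.
Qed.

(** For p >= sqrt x, 1 <= 2 log p / log x reduces to Chebyshev sums, contributing 8 x / log x. The
    primes below sqrt x contribute at most (1 + log x) sqrt x <= 16 x / log x. The bound controls
    both the number of primes and the size of the resonator. *)
Lemma prime_log_weight_le x : (1 < x)%N ->
  \sum_(1 <= p < x.+1 | prime p) (1 + (ln (INR x) - ln (INR p))) <= 24 * (INR x / ln (INR x)).
Proof.
move=> x1; have lx := ln_INR_gt0 x1; have x0 := INR_gt0 (ltnW x1).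
have hx1 := INR_ge1 (ltnW x1).
have l4 := ln4_le2.
apply: (Rle_trans _ (\sum_(1 <= p < x.+1 | prime p)
   ((2 / ln (INR x)) * (ln (INR p) + ln (INR p) * (ln (INR x) - ln (INR p))) +
    (1 + ln (INR x)) * (if Rlt_dec (INR p * INR p) (INR x) then 1 else 0)))).
  apply: sum_le => p; rewrite mem_index_iota => /andP[p0 px] pp.
  have hp := INR_gt0 p0; have lp := ln_INR_ge0 p0.
  have lpx := ln_INR_le p0 px.
  have d : 0 <= ln (INR p) + ln (INR p) * (ln (INR x) - ln (INR p)).
    by have := Rmult_le_pos (ln (INR p)) (ln (INR x) - ln (INR p)); lra.
  have d2 : 0 <= (2 / ln (INR x)) * (ln (INR p) + ln (INR p) * (ln (INR x) - ln (INR p))).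
    by apply: Rmult_le_pos => //; apply: Rdiv_le_0_compat; lra.
  case: Rlt_dec => h; cbn [is_left]; first lra.
  have h2 : ln (INR x) <= 2 * ln (INR p).
    by have := ln_le _ _ x0 (Rnot_lt_le _ _ h); rewrite ln_mult //; lra.
  rewrite Rmult_0_r Rplus_0_r; apply: (Rmult_le_reg_l (ln (INR x))) => //.
  have -> : ln (INR x) * (2 / ln (INR x) * (ln (INR p) + ln (INR p) * (ln (INR x) - ln (INR p)))) =
    (2 * ln (INR p)) * (1 + (ln (INR x) - ln (INR p))) by field; lra.
  by apply: Rmult_le_compat_r; lra.
rewrite big_split /= -!big_distrr /= big_split /=.
have h1 := lnp_ln_quot_le x; have h2 := theta_le x; rewrite /theta in h2.
have h3 : \sum_(1 <= p < x.+1 | prime p) (if Rlt_dec (INR p * INR p) (INR x) then 1 else 0) <= sqrt (INR x).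
  apply: Rle_trans (Rle_trans _ _ _ (@count_below_sqrt (INR x) x (Rlt_le _ _ x0)) (Rmin_r _ _)).
  by rewrite big_mkcond; apply: sum_le => p _ _; case: ifP => _; case: Rlt_dec => _ /=; lra.
have h4 := ln_mult_ln_le hx1; have hs := sqrt_sqrt _ (Rlt_le _ _ x0); have hs0 := sqrt_pos (INR x).
have h5 : (1 + ln (INR x)) * sqrt (INR x) <= 16 * (INR x / ln (INR x)).
  apply: (Rmult_le_reg_l (ln (INR x))) => //.
  have -> : ln (INR x) * (16 * (INR x / ln (INR x))) = 16 * (sqrt (INR x) * sqrt (INR x)).
    by rewrite hs; field; lra.
  by have := Rmult_le_compat_r _ _ _ hs0 h4; lra.
apply: (Rle_trans _ (2 / ln (INR x) * (4 * INR x) + 16 * (INR x / ln (INR x)))); last by right; field; lra.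
apply: Rplus_le_compat.
  apply: Rmult_le_compat_l; first by apply: Rdiv_le_0_compat; lra.
  have := Rmult_le_compat_l _ _ _ (Rlt_le _ _ x0) l4; lra.
apply: Rle_trans h5; apply: Rmult_le_compat_l; lra.
Qed.

(** * Dirichlet sums approximating zeta on the 1-line *)

(** The sequences a(N) - K/(N+1) and a(N) + K/(N+1) are monotone in opposite directions with a
    common limit. In particular [Lim_seq] is a genuine finite limit here. *)
Lemma lim_seq_rate (a : nat -> R) K : 0 <= K ->
  (forall N, Rabs (a N.+1 - a N) <= K * (/ INR N.+1 - / INR N.+2)) ->
  forall N, Rabs (real (Lim_seq a) - a N) <= K / INR N.+1.
Proof.
move=> K0 h.
pose v N := a N - K / INR N.+1; pose w N := a N + K / INR N.+1.
have hk N : 0 <= K / INR N.+1 by apply: Rdiv_le_0_compat => //; exact: INR_gt0.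
have hh N : - (K / INR N.+1 - K / INR N.+2) <= a N.+1 - a N <= K / INR N.+1 - K / INR N.+2.
  have := Rabs_le_between (a N.+1 - a N) (K * (/ INR N.+1 - / INR N.+2)).
  by move=> [/(_ (h N))]; rewrite /Rdiv; lra.
have hv N : v N <= v N.+1 by rewrite /v; have := hh N; lra.
have hw N : w N.+1 <= w N by rewrite /w; have := hh N; lra.
have hw0 N : w N <= w 0%N by elim: N => [|N ih]; [lra|have := hw N; lra].
have ev : ex_finite_lim_seq v.
  apply: (ex_finite_lim_seq_incr v (w 0%N)) => // N.
  by apply: Rle_trans (hw0 N); rewrite /v /w; have := hk N; lra.
have {ev} [l hl] := ev.
have hz : is_lim_seq (fun N => K / INR N.+1) 0.
  rewrite (_ : Rbar.Finite 0 = Rbar_mult K 0); last by rewrite /= Rmult_0_r.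
  apply: is_lim_seq_scal_l.
  apply/(is_lim_seq_incr_1 (fun n => / INR n)).
  rewrite (_ : Rbar.Finite 0 = Rbar_inv p_infty) //.
  by apply: is_lim_seq_inv; [exact: is_lim_seq_INR|].
have ha : is_lim_seq a l.
  apply: (is_lim_seq_ext (fun N => v N + K / INR N.+1)); first by move=> N; rewrite /v; ring.
  by rewrite -(Rplus_0_r l); apply: is_lim_seq_plus'.
have hw' : is_lim_seq w l by rewrite -(Rplus_0_r l); apply: is_lim_seq_plus'.
rewrite (is_lim_seq_unique _ _ ha) => N; cbn [real].
have h1 := is_lim_seq_incr_compare v _ hl hv N.
have h2 := is_lim_seq_decr_compare w _ hw' hw N.
by apply/Rabs_le_between; move: h1 h2; rewrite /v /w; lra.
Qed.

(** Two mean value theorems write the difference as g'(d) (n+1-c) with n < c < d < n+1. The factor 2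
    comes from 1/n^2 <= 2 (1/n - 1/(n+1)), which makes the errors telescope. *)
Lemma euler_maclaurin_step (f g dg : R -> R) K n : (0 < n)%N ->
  (forall x, 0 < x -> is_derive f x (g x)) -> (forall x, 0 < x -> is_derive g x (dg x)) ->
  (forall x, 0 < x -> Rabs (dg x) <= K / x ^ 2) ->
  Rabs (g (INR n.+1) - (f (INR n.+1) - f (INR n))) <= 2 * K * (/ INR n - / INR n.+1).
Proof.
move=> n0 hf hg hdg; have h := INR_gt0 n0; rewrite S_INR.
have K0 : 0 <= K by have := hdg 1 Rlt_0_1; have := Rabs_pos (dg 1); rewrite /Rdiv pow1 Rinv_1; lra.
have [c [e hc]] := MVT_cor2 f g (INR n) (INR n + 1) ltac:(lra)
  (fun c hc => proj1 (is_derive_Reals _ _ _) (hf c (Rlt_le_trans _ _ _ h (proj1 hc)))).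
have c0 : 0 < c by lra.
have [d [e2 hd]] := MVT_cor2 g dg c (INR n + 1) (proj2 hc)
  (fun d hd => proj1 (is_derive_Reals _ _ _) (hg d (Rlt_le_trans _ _ _ c0 (proj1 hd)))).
have -> : g (INR n + 1) - (f (INR n + 1) - f (INR n)) = dg d * (INR n + 1 - c) by lra.
rewrite Rabs_mult (Rabs_pos_eq (INR n + 1 - c)); last lra.
have d0 : 0 < d by lra.
apply: (Rle_trans _ (K / d ^ 2 * 1)).
  by apply: Rmult_le_compat; [exact: Rabs_pos|lra|exact: hdg|lra].
have n1 := INR_ge1 n0.
apply: (Rle_trans _ (K / INR n ^ 2)).
  rewrite Rmult_1_r; apply: Rmult_le_compat_l => //.
  by apply: Rinv_le_contravar; [apply: pow_lt|apply: pow_incr; lra].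
have -> : 2 * K * (/ INR n - / (INR n + 1)) = K / INR n ^ 2 * (2 * INR n / (INR n + 1)) by field; lra.
rewrite -{1}(Rmult_1_r (K / INR n ^ 2)); apply: Rmult_le_compat_l.
  by apply: Rdiv_le_0_compat => //; exact: pow_lt.
by apply/Rle_div_r; lra.
Qed.

Lemma euler_maclaurin_lim (f g dg : R -> R) K (a : nat -> R) :
  (forall x, 0 < x -> is_derive f x (g x)) -> (forall x, 0 < x -> is_derive g x (dg x)) ->
  (forall x, 0 < x -> Rabs (dg x) <= K / x ^ 2) ->
  (forall N, a N = \sum_(1 <= n < N.+2) g (INR n) - f (INR N.+1)) ->
  forall N, Rabs (real (Lim_seq a) - a N) <= 2 * K / INR N.+1.
Proof.
move=> hf hg hdg ha; apply: lim_seq_rate.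
  by have := hdg 1 Rlt_0_1; have := Rabs_pos (dg 1); rewrite /Rdiv pow1 Rinv_1; lra.
move=> N; have := euler_maclaurin_step (ltn0Sn N) hf hg hdg.
rewrite !ha (@sum_nat_recr _ N.+2) //.
set A := \sum_(_ <= _ < _) _.
by rewrite (_ : A + g (INR N.+2) - f (INR N.+2) - (A - f (INR N.+1)) = g (INR N.+2) - (f (INR N.+2) - f (INR N.+1))); [|ring].
Qed.

Definition zpart_re N u := \sum_(1 <= n < N.+1) cos (u * ln (INR n)) / INR n.
Definition zpart_im N u := \sum_(1 <= n < N.+1) - (sin (u * ln (INR n)) / INR n).

(** The 1/u is the omitted term N^(1-s)/(1-s); the rest is the tail estimate, as cos(u log x)/x has
    derivative at most (u+1)/x^2. *)
Lemma zeta1_re_approx u N : 0 < u ->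
  Rabs (zeta1_re u - zpart_re N.+1 u) <= / u + 2 * (u + 1) / INR N.+1.
Proof.
move=> u0.
set t := sin (u * ln (INR N.+1)) / u.
suff h : Rabs (zeta1_re u - (zpart_re N.+1 u - t)) <= 2 * (u + 1) / INR N.+1.
  have -> : zeta1_re u - zpart_re N.+1 u = (zeta1_re u - (zpart_re N.+1 u - t)) + - t by ring.
  apply: Rle_trans (Rabs_triang _ _) _; rewrite Rabs_Ropp Rplus_comm.
  apply: Rplus_le_compat h; rewrite /t /Rdiv Rabs_mult (Rabs_pos_eq (/ u)); last first.
    by left; apply: Rinv_0_lt_compat.
  rewrite -{2}(Rmult_1_l (/ u)); apply: Rmult_le_compat_r.
    by left; apply: Rinv_0_lt_compat.
  by apply/Rabs_le_between; exact: SIN_bound.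
pose f x := sin (u * ln x) / u; pose g x := cos (u * ln x) / x.
pose dg x := - (u * sin (u * ln x) + cos (u * ln x)) / x ^ 2.
rewrite /zeta1_re.
set a := fun N => _ - _.
have ha M : a M = \sum_(1 <= n < M.+2) g (INR n) - f (INR M.+1).
  by rewrite /a (sum_f_R0_shift (fun n => cos (u * ln (INR n)) / INR n)) Nat.add_1_r.
have -> : zpart_re N.+1 u - t = a N by rewrite ha.
apply: (euler_maclaurin_lim (f := f) (g := g) (dg := dg)) => // x x0.
- by rewrite /f /g; auto_derive; [|field; lra].
- by rewrite /g /dg; auto_derive; [split => //; lra|field; lra].
rewrite /dg Rabs_mult Rabs_inv (Rabs_pos_eq (x ^ 2)); last by apply: pow_le; lra.
apply: Rmult_le_compat_r; first by left; apply: Rinv_0_lt_compat; apply: pow_lt.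
rewrite Rabs_Ropp; have := SIN_bound (u * ln x); have := COS_bound (u * ln x) => h1 h2.
by apply/Rabs_le_between; nra.
Qed.

Lemma zeta1_im_approx u N : 0 < u ->
  Rabs (zeta1_im u - zpart_im N.+1 u) <= / u + 2 * (u + 1) / INR N.+1.
Proof.
move=> u0.
set t := cos (u * ln (INR N.+1)) / u.
suff h : Rabs (zeta1_im u - (zpart_im N.+1 u - t)) <= 2 * (u + 1) / INR N.+1.
  have -> : zeta1_im u - zpart_im N.+1 u = (zeta1_im u - (zpart_im N.+1 u - t)) + - t by ring.
  apply: Rle_trans (Rabs_triang _ _) _; rewrite Rabs_Ropp Rplus_comm.
  apply: Rplus_le_compat h; rewrite /t /Rdiv Rabs_mult (Rabs_pos_eq (/ u)); last first.
    by left; apply: Rinv_0_lt_compat.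
  rewrite -{2}(Rmult_1_l (/ u)); apply: Rmult_le_compat_r.
    by left; apply: Rinv_0_lt_compat.
  by apply/Rabs_le_between; exact: COS_bound.
pose f x := cos (u * ln x) / u; pose g x := - (sin (u * ln x) / x).
pose dg x := (sin (u * ln x) - u * cos (u * ln x)) / x ^ 2.
rewrite /zeta1_im.
set a := fun N => _ - _.
have ha M : a M = \sum_(1 <= n < M.+2) g (INR n) - f (INR M.+1).
  rewrite /a (sum_f_R0_shift (fun n => sin (u * ln (INR n)) / INR n)) Nat.add_1_r.
  congr (_ - _); rewrite (big_morph Ropp (id1 := 0) (op1 := Rplus)) //; [exact: Ropp_plus_distr|exact: Ropp_0].
have -> : zpart_im N.+1 u - t = a N by rewrite ha.
apply: (euler_maclaurin_lim (f := f) (g := g) (dg := dg)) => // x x0.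
- by rewrite /f /g; auto_derive; [|field; lra].
- by rewrite /g /dg; auto_derive; [split => //; lra|field; lra].
rewrite /dg Rabs_mult Rabs_inv (Rabs_pos_eq (x ^ 2)); last by apply: pow_le; lra.
apply: Rmult_le_compat_r; first by left; apply: Rinv_0_lt_compat; apply: pow_lt.
have := SIN_bound (u * ln x); have := COS_bound (u * ln x) => h1 h2.
by apply/Rabs_le_between; nra.
Qed.

(** * The resonance method *)

HB.instance Definition _ := Monoid.isComLaw.Build C (RtoC 0) Cplus Cplus_assoc Cplus_comm Cplus_0_l.
HB.instance Definition _ := Monoid.isComLaw.Build C (RtoC 1) Cmult Cmult_assoc Cmult_comm Cmult_1_l.

Definition cis (x : R) : C := (cos x, sin x).

Lemma cis_add x y : cis (x + y) = Cmult (cis x) (cis y).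
Proof.
by rewrite /cis cos_plus sin_plus /Cmult /=; congr (_, _); ring.
Qed.

Lemma cis0 : cis 0 = RtoC 1.
Proof. by rewrite /cis cos_0 sin_0. Qed.

Lemma Cmod_cis x : Cmod (cis x) = 1.
Proof.
rewrite /Cmod /cis /=; have := sin2_cos2 x; rewrite /Rsqr => h.
by rewrite (_ : _ + _ = 1) ?sqrt_1 //; lra.
Qed.

Lemma cis_mult_conj x : Cmult (cis x) (cis (- x)) = RtoC 1.
Proof. by rewrite -cis_add Rplus_opp_r cis0. Qed.

Lemma cis_pow x n : Cpow (cis x) n = cis (INR n * x).
Proof.
elim: n => [|n ih]; first by rewrite /= Rmult_0_l cis0.
by rewrite S_INR Rmult_plus_distr_r Rmult_1_l Rplus_comm cis_add -ih.
Qed.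

(** * Functions with nonnegative Fourier coefficients *)

(** The closure of the characters under nonnegative combinations and pointwise limits. This replaces
    representation by positive measures: products and averages are handled by induction on the
    construction. *)
Inductive pos_def : (R -> C) -> Prop :=
| pos_def_char lam : pos_def (fun t => cis (lam * t))
| pos_def_add f g : pos_def f -> pos_def g -> pos_def (fun t => Cplus (f t) (g t))
| pos_def_scale c f : 0 <= c -> pos_def f -> pos_def (fun t => Cmult (RtoC c) (f t))
| pos_def_lim (u : nat -> R -> C) f : (forall n, pos_def (u n)) ->
    (forall t eps, 0 < eps ->
      exists N, forall n, (N <= n)%N -> Cmod (Cminus (u n t) (f t)) < eps) ->
    pos_def f.

Lemma Cminus_diag z : Cminus z z = RtoC 0.
Proof. by ring. Qed.

(** A constant sequence converges pointwise to any function with the same values, so functional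
    extensionality is avoided. *)
Lemma pos_def_ext f g : (forall t, f t = g t) -> pos_def f -> pos_def g.
Proof.
move=> e hf; apply: (@pos_def_lim (fun _ => f)) => // t eps he; exists 0%N => n _.
by rewrite e Cminus_diag Cmod_0.
Qed.

Lemma pos_def_0 : pos_def (fun _ => RtoC 0).
Proof.
apply: pos_def_ext (pos_def_scale (Rle_refl 0) (pos_def_char 0)) => t.
by rewrite Cmult_0_l.
Qed.

Lemma pos_def_const c : 0 <= c -> pos_def (fun _ => RtoC c).
Proof.
move=> hc; apply: pos_def_ext (pos_def_scale hc (pos_def_char 0)) => t.
by rewrite Rmult_0_l cis0 Cmult_1_r.
Qed.

Lemma pos_def_lim_mult (u : nat -> R -> C) f h :
  (forall n, pos_def (fun t => Cmult (u n t) (h t))) ->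
  (forall t eps, 0 < eps ->
     exists N, forall n, (N <= n)%N -> Cmod (Cminus (u n t) (f t)) < eps) ->
  pos_def (fun t => Cmult (f t) (h t)).
Proof.
move=> hu hl; apply: (@pos_def_lim (fun n t => Cmult (u n t) (h t))) => // t eps he.
have hp : 0 < 1 + Cmod (h t) by have := Cmod_ge_0 (h t); lra.
have [|N hN] := hl t (eps / (1 + Cmod (h t))); first exact: Rdiv_lt_0_compat.
exists N => n /hN hn.
have -> : Cminus (Cmult (u n t) (h t)) (Cmult (f t) (h t)) = Cmult (Cminus (u n t) (f t)) (h t) by ring.
rewrite Cmod_mult; apply: (Rle_lt_trans _ (Cmod (Cminus (u n t) (f t)) * (1 + Cmod (h t)))).
  by apply: Rmult_le_compat_l; [exact: Cmod_ge_0|lra].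
by move: hn; move/Rlt_div_r; apply.
Qed.

Lemma pos_def_mult f g : pos_def f -> pos_def g -> pos_def (fun t => Cmult (f t) (g t)).
Proof.
move=> hf hg; elim: hf => {f} [lam|f1 f2 _ h1 _ h2|c f c0 _ h|u f _ hu hl].
- elim: hg => {g} [mu|g1 g2 _ h1 _ h2|c g c0 _ h|u g _ hu hl].
  + by apply: pos_def_ext (pos_def_char (lam + mu)) => t; rewrite Rmult_plus_distr_r cis_add.
  + by apply: pos_def_ext (pos_def_add h1 h2) => t; ring.
  + by apply: pos_def_ext (pos_def_scale c0 h) => t; ring.
  + apply: (pos_def_ext (f := fun t => Cmult (g t) (cis (lam * t)))); first by move=> t; ring.
    apply: pos_def_lim_mult hl => n; apply: pos_def_ext (hu n) => t; ring.
- by apply: pos_def_ext (pos_def_add h1 h2) => t; ring.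
- by apply: pos_def_ext (pos_def_scale c0 h) => t; ring.
- exact: pos_def_lim_mult hu hl.
Qed.

(** The integer t = a - b is counted K - |t| times, a Fejer weight. *)
Definition toeplitz K (f : R -> R) := \sum_(0 <= a < K) \sum_(0 <= b < K) f (INR a - INR b).

Lemma toeplitz_add K f g : toeplitz K (fun t => f t + g t) = toeplitz K f + toeplitz K g.
Proof. by rewrite /toeplitz -big_split; apply: eq_bigr => a _; rewrite -big_split. Qed.

Lemma toeplitz_scale K c f : toeplitz K (fun t => c * f t) = c * toeplitz K f.
Proof. by rewrite /toeplitz big_distrr; apply: eq_bigr => a _; rewrite big_distrr. Qed.

Lemma toeplitz_const K c : toeplitz K (fun _ => c) = INR K ^ 2 * c.
Proof.
rewrite /toeplitz (eq_bigr (fun _ => INR K * c)) => [|a _].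
  by rewrite sum_const count_predT size_iota subn0 /=; ring.
by rewrite sum_const count_predT size_iota subn0.
Qed.

Lemma toeplitz_pos_def K f : pos_def f -> 0 <= toeplitz K (fun t => Re (f t)).
Proof.
elim=> {f} [lam|f g _ hf _ hg|c f c0 _ hf|u f _ hu hl].
- have -> : toeplitz K (fun t => Re (cis (lam * t))) =
    (\sum_(0 <= a < K) cos (lam * INR a)) ^ 2 + (\sum_(0 <= a < K) sin (lam * INR a)) ^ 2.
    rewrite /= !Rmult_1_r !big_distrl -big_split /=; apply: eq_bigr => a _.
    rewrite !big_distrr -big_split /=; apply: eq_bigr => b _.
    by rewrite Rmult_minus_distr_l cos_minus.
  have := pow2_ge_0 (\sum_(0 <= a < K) cos (lam * INR a)).
  have := pow2_ge_0 (\sum_(0 <= a < K) sin (lam * INR a)); lra.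
- change (0 <= toeplitz K (fun t => Re (f t) + Re (g t))); rewrite toeplitz_add; lra.
- have -> : toeplitz K (fun t => Re (Cmult (RtoC c) (f t))) = c * toeplitz K (fun t => Re (f t)).
    rewrite -toeplitz_scale; apply: eq_bigr => a _; apply: eq_bigr => b _.
    by rewrite /Re /=; ring.
  exact: Rmult_le_pos.
- suff key eps : 0 < eps -> - (INR K ^ 2 * eps) <= toeplitz K (fun t => Re (f t)).
    apply: le_epsilon => e he.
    have hK : 0 < INR K ^ 2 + 1 by have := pow2_ge_0 (INR K); lra.
    have := key (e / (INR K ^ 2 + 1)) (Rdiv_lt_0_compat _ _ he hK).
    have : INR K ^ 2 * (e / (INR K ^ 2 + 1)) <= e; last lra.
    have -> : INR K ^ 2 * (e / (INR K ^ 2 + 1)) = e - e / (INR K ^ 2 + 1) by field; lra.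
    by have := Rdiv_lt_0_compat _ _ he hK; lra.
  move=> he.
  (* Only finitely many differences a - b occur, so pointwise convergence is uniform on them. *)
  have [N hN] : exists N, forall a b, (a < K)%N -> (b < K)%N ->
      Cmod (Cminus (u N (INR a - INR b)) (f (INR a - INR b))) < eps.
    suff [N hN] : exists N, forall n, (N <= n)%N -> forall a b, (a < K)%N -> (b < K)%N ->
      Cmod (Cminus (u n (INR a - INR b)) (f (INR a - INR b))) < eps.
      by exists N => a b; exact: hN.
    have row a k : exists N, forall n, (N <= n)%N -> forall b, (b < k)%N ->
      Cmod (Cminus (u n (INR a - INR b)) (f (INR a - INR b))) < eps.
      elim: k => [|k [N hN]]; first by exists 0%N.
      have [M hM] := hl (INR a - INR k) eps he.
      exists (maxn N M) => n; rewrite geq_max => /andP[nN nM] b.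
      by rewrite ltnS leq_eqVlt => /orP[/eqP ->|bk]; [exact: hM|exact: hN].
    elim: {1}K => [|k [N hN]]; first by exists 0%N.
    have [M hM] := row k K.
    exists (maxn N M) => n; rewrite geq_max => /andP[nN nM] a b.
    by rewrite ltnS leq_eqVlt => /orP[/eqP ->|ak] bK; [exact: hM|exact: hN].
  have := hu N; have : toeplitz K (fun t => Re (u N t)) <=
      toeplitz K (fun t => Re (f t) + eps); last first.
    by rewrite toeplitz_add toeplitz_const; lra.
  apply: sum_le => a; rewrite mem_index_iota => /andP[_ ha] _.
  apply: sum_le => b; rewrite mem_index_iota => /andP[_ hb] _.
  have := hN a b ha hb; have := re_le_Cmod (Cminus (u N (INR a - INR b)) (f (INR a - INR b))).
  rewrite {1}/Re /= => h1 h2.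
  have := Rle_abs (fst (u N (INR a - INR b)) + - fst (f (INR a - INR b))).
  rewrite /Re; lra.
Qed.

(** * The resonator and its twisted averages *)

Definition one_minus (r x : R) : C := Cminus (RtoC 1) (Cmult (RtoC r) (cis x)).

Lemma Cmod_one_minus r x : 0 <= r < 1 -> 1 - r <= Cmod (one_minus r x).
Proof.
move=> hr; have := Cmod_triangle (one_minus r x) (Cmult (RtoC r) (cis x)).
have -> : Cplus (one_minus r x) (Cmult (RtoC r) (cis x)) = RtoC 1 by rewrite /one_minus; ring.
rewrite Cmod_mult Cmod_cis !Cmod_R Rabs_R1 Rabs_pos_eq; lra.
Qed.

Lemma one_minus_neq0 r x : 0 <= r < 1 -> one_minus r x <> RtoC 0.
Proof.
by move=> hr e; have := Cmod_one_minus x hr; rewrite e Cmod_0; lra.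
Qed.

Lemma pos_def_geom r lam : 0 <= r < 1 -> pos_def (fun t => Cinv (one_minus r (lam * t))).
Proof.
move=> hr.
pose z t := Cmult (RtoC r) (cis (lam * t)).
pose u n t := \big[Cplus/RtoC 0]_(0 <= k < n) Cpow (z t) k.
have hz n t : Cmult (one_minus r (lam * t)) (u n t) = Cminus (RtoC 1) (Cpow (z t) n).
  rewrite /u; elim: n => [|n ih]; first by rewrite big_geq //= /one_minus; ring.
  by rewrite big_nat_recr //= Cmult_plus_distr_l ih /one_minus -/(z t); ring.
apply: (@pos_def_lim u) => [n|t eps he].
  rewrite /u; elim: n => [|n ih].
    by apply: pos_def_ext pos_def_0 => t; rewrite big_geq.
  apply: (pos_def_ext (f := fun t => Cplus (u n t) (Cpow (z t) n))).
    by move=> t; rewrite /u big_nat_recr.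
  apply: pos_def_add => //.
  have hp : 0 <= r ^ n by apply: pow_le; lra.
  apply: pos_def_ext (pos_def_scale hp (pos_def_char (INR n * lam))) => t.
  rewrite /z Rmult_assoc -cis_pow RtoC_pow.
  by elim: n {ih hp} => [|n ih] /=; [ring|rewrite -[Cpow (Cmult _ _) n]ih; ring].
have h1r : 0 < eps * (1 - r) by apply: Rmult_lt_0_compat; lra.
have [|N hN] := pow_lt_1_zero r _ (eps * (1 - r)) h1r; first by rewrite Rabs_pos_eq; lra.
exists N => n /leP nN; have {}hN := hN n nN.
have n0 := @one_minus_neq0 r (lam * t) hr.
have -> : Cminus (u n t) (Cinv (one_minus r (lam * t))) =
    Cmult (Copp (Cpow (z t) n)) (Cinv (one_minus r (lam * t))).
  have -> : u n t = Cmult (Cminus (RtoC 1) (Cpow (z t) n)) (Cinv (one_minus r (lam * t))).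
    by rewrite -hz; field.
  by ring.
have hc := Cmod_one_minus (lam * t) hr.
rewrite Cmod_mult Cmod_opp Cmod_inv // Cmod_pow Cmod_mult Cmod_cis Cmod_R Rmult_1_r.
rewrite RPow_abs; apply: (Rmult_lt_reg_r (Cmod (one_minus r (lam * t)))); first lra.
rewrite Rmult_assoc Rinv_l; last lra.
rewrite Rmult_1_r; apply: Rlt_le_trans hN _.
by apply: Rmult_le_compat_l; lra.
Qed.

(** Q written as a product of conjugate factors, the form in which its coefficients are visibly
    nonnegative; [weight] is the same function as a real number, used for size. *)
Definition resonator (ps : seq nat) (r : nat -> R) (t : R) : C :=
  \big[Cmult/RtoC 1]_(p <- ps) Cmult (Cinv (one_minus (r p) (ln (INR p) * t)))
                                     (Cinv (one_minus (r p) (- ln (INR p) * t))).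

Definition weight (ps : seq nat) (r : nat -> R) (t : R) : R :=
  \prod_(p <- ps) / (Cmod (one_minus (r p) (ln (INR p) * t)) ^ 2).

Lemma one_minus_conj r x :
  Cmult (one_minus r x) (one_minus r (- x)) = RtoC (Cmod (one_minus r x) ^ 2).
Proof.
rewrite /Cmod pow2_sqrt; last by apply: Rplus_le_le_0_compat; exact: pow2_ge_0.
by rewrite /one_minus /cis cos_neg sin_neg /Cmult /Cminus /Cplus /Copp /RtoC /=; congr (_, _); ring.
Qed.

Lemma resonator_weight ps r t : (forall p, p \in ps -> 0 <= r p < 1) ->
  resonator ps r t = RtoC (weight ps r t).
Proof.
move=> hr; rewrite /resonator /weight.
rewrite (big_morph RtoC RtoC_mult (erefl (RtoC 1))) !big_seq.
apply: eq_bigr => p /hr hp.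
have n0 x := @one_minus_neq0 (r p) x hp.
have c0 := Cmod_one_minus (ln (INR p) * t) hp.
rewrite RtoC_inv; last by apply: pow_nonzero; lra.
rewrite -one_minus_conj Ropp_mult_distr_l.
by field; split; apply: n0.
Qed.

Lemma weight_bounds ps r t : (forall p, p \in ps -> 0 <= r p < 1) ->
  0 <= weight ps r t <= \prod_(p <- ps) (/ (1 - r p) ^ 2).
Proof.
move=> hr; apply: prod_le => p /hr hp _.
have c0 := Cmod_one_minus (ln (INR p) * t) hp.
split; first by left; apply: Rinv_0_lt_compat; apply: pow_lt; lra.
by apply: Rinv_le_contravar; [apply: pow_lt; lra|apply: pow_incr; lra].
Qed.

Lemma pos_def_resonator ps r : (forall p, p \in ps -> 0 <= r p < 1) -> pos_def (resonator ps r).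
Proof.
elim: ps => [_|p ps ih hr].
  by apply: pos_def_ext (pos_def_const Rle_0_1) => t; rewrite /resonator big_nil.
have hp := hr _ (mem_head _ _).
apply: (pos_def_ext (f := fun t => Cmult (Cmult (Cinv (one_minus (r p) (ln (INR p) * t)))
  (Cinv (one_minus (r p) (- ln (INR p) * t)))) (resonator ps r t))).
  by move=> t; rewrite /resonator big_cons.
apply: pos_def_mult; first by apply: pos_def_mult; exact: pos_def_geom.
by apply: ih => q qs; apply: hr; rewrite inE qs orbT.
Qed.

Lemma pos_def_minus1_mult f g :
  pos_def f -> pos_def (fun t => Cminus (f t) (RtoC 1)) ->
  pos_def g -> pos_def (fun t => Cminus (g t) (RtoC 1)) ->
  pos_def (fun t => Cminus (Cmult (f t) (g t)) (RtoC 1)).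
Proof.
move=> hf hf1 hg hg1.
by apply: pos_def_ext (pos_def_add (pos_def_mult hf1 hg) hg1) => t; ring.
Qed.

Lemma pos_def_geom_minus1 r lam : 0 <= r < 1 ->
  pos_def (fun t => Cminus (Cinv (one_minus r (lam * t))) (RtoC 1)).
Proof.
move=> hr.
apply: pos_def_ext (pos_def_scale (proj1 hr) (pos_def_mult (pos_def_char lam) (pos_def_geom lam hr))) => t.
have := @one_minus_neq0 r (lam * t) hr; rewrite /one_minus => n0; field => //.
Qed.

(** The constant coefficient of Q is at least 1, so the total Toeplitz mass of Q is at least K^2. *)
Lemma pos_def_resonator_minus1 ps r : (forall p, p \in ps -> 0 <= r p < 1) ->
  pos_def (fun t => Cminus (resonator ps r t) (RtoC 1)).
Proof.
elim: ps => [_|p ps ih hr].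
  by apply: pos_def_ext pos_def_0 => t; rewrite /resonator big_nil Cminus_diag.
have hp := hr _ (mem_head _ _).
have hs q : q \in ps -> 0 <= r q < 1 by move=> qs; apply: hr; rewrite inE qs orbT.
apply: (pos_def_ext (f := fun t => Cminus (Cmult (Cmult (Cinv (one_minus (r p) (ln (INR p) * t)))
  (Cinv (one_minus (r p) (- ln (INR p) * t)))) (resonator ps r t)) (RtoC 1))).
  by move=> t; rewrite /resonator big_cons.
apply: pos_def_minus1_mult.
- by apply: pos_def_mult; exact: pos_def_geom.
- by apply: pos_def_minus1_mult; solve [exact: pos_def_geom|exact: pos_def_geom_minus1].
- exact: pos_def_resonator.
- exact: ih.
Qed.

(* [(Z - rho) Q] has nonnegative Fourier coefficients, so that weighting by [Q] makes
   the average of [Z] at least [rho]. *)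
Definition dominates (Q Z : R -> C) (rho : R) :=
  pos_def Z /\ 0 <= rho /\ pos_def (fun t => Cmult (Cminus (Z t) (RtoC rho)) (Q t)).

Lemma dominates_ext Q Z Z' rho : (forall t, Z t = Z' t) -> dominates Q Z rho -> dominates Q Z' rho.
Proof.
move=> e [h1 [h2 h3]]; split; first exact: pos_def_ext h1.
by split => //; apply: pos_def_ext h3 => t; rewrite e.
Qed.

Lemma dominates_char Q lam : pos_def Q -> dominates Q (fun t => cis (lam * t)) 0.
Proof.
move=> hQ; split; [exact: pos_def_char|split; [lra|]].
by apply: pos_def_ext (pos_def_mult (pos_def_char lam) hQ) => t; ring.
Qed.

Lemma dominates_const Q c : 0 <= c -> dominates Q (fun _ => RtoC c) c.
Proof.
move=> hc; split; [exact: pos_def_const|split => //].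
by apply: pos_def_ext pos_def_0 => t; ring.
Qed.

(** Z Z' - rho rho' = Z' (Z - rho) + rho (Z' - rho'). *)
Lemma dominates_mult Q Z Z' rho rho' : dominates Q Z rho -> dominates Q Z' rho' ->
  dominates Q (fun t => Cmult (Z t) (Z' t)) (rho * rho').
Proof.
move=> [h1 [h2 h3]] [h1' [h2' h3']]; split; first exact: pos_def_mult.
split; first exact: Rmult_le_pos.
apply: pos_def_ext (pos_def_add (pos_def_mult h1' h3) (pos_def_scale h2 h3')) => t.
by rewrite RtoC_mult; ring.
Qed.

Lemma dominates_add Q Z Z' rho rho' : dominates Q Z rho -> dominates Q Z' rho' ->
  dominates Q (fun t => Cplus (Z t) (Z' t)) (rho + rho').
Proof.
move=> [h1 [h2 h3]] [h1' [h2' h3']]; split; first exact: pos_def_add.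
split; first lra.
by apply: pos_def_ext (pos_def_add h3 h3') => t; rewrite RtoC_plus; ring.
Qed.

Lemma dominates_sum Q (I : eqType) (s : seq I) (Z : I -> R -> C) (rho : I -> R) :
  (forall i, i \in s -> dominates Q (Z i) (rho i)) ->
  dominates Q (fun t => \big[Cplus/RtoC 0]_(i <- s) Z i t) (\sum_(i <- s) rho i).
Proof.
elim: s => [_|i s ih h].
  rewrite big_nil; apply: dominates_ext (dominates_const Q (Rle_refl 0)) => t.
  by rewrite big_nil.
rewrite big_cons; apply: (dominates_ext (Z := fun t => Cplus (Z i t) (\big[Cplus/RtoC 0]_(i <- s) Z i t))).
  by move=> t; rewrite big_cons.
apply: dominates_add; first by apply: h; exact: mem_head.
by apply: ih => j js; apply: h; rewrite inE js orbT.
Qed.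

Lemma dominates_prod Q (I : eqType) (s : seq I) (Z : I -> R -> C) (rho : I -> R) :
  (forall i, i \in s -> dominates Q (Z i) (rho i)) ->
  dominates Q (fun t => \big[Cmult/RtoC 1]_(i <- s) Z i t) (\prod_(i <- s) rho i).
Proof.
elim: s => [_|i s ih h].
  rewrite big_nil; apply: dominates_ext (dominates_const Q Rle_0_1) => t.
  by rewrite big_nil.
rewrite big_cons; apply: (dominates_ext (Z := fun t => Cmult (Z i t) (\big[Cmult/RtoC 1]_(i <- s) Z i t))).
  by move=> t; rewrite big_cons.
apply: dominates_mult; first by apply: h; exact: mem_head.
by apply: ih => j js; apply: h; rewrite inE js orbT.
Qed.

(* [e^(-ix) - r = e^(-ix) (1 - r e^(ix))], which cancels one of the two Euler factors at [p]. *)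
Lemma dominates_prime ps r p : uniq ps -> (forall p, p \in ps -> 0 <= r p < 1) -> p \in ps ->
  dominates (resonator ps r) (fun t => cis (- ln (INR p) * t)) (r p).
Proof.
move=> ups hr pps; have hp := hr _ pps; split; first exact: pos_def_char.
split; first lra.
have hs : forall q, q \in rem p ps -> 0 <= r q < 1 by move=> q /mem_rem; exact: hr.
apply: pos_def_ext (pos_def_mult (pos_def_char (- ln (INR p))) (pos_def_mult
  (pos_def_geom (- ln (INR p)) hp) (pos_def_resonator hs))) => t.
rewrite {2}/resonator (perm_big _ (perm_to_rem pps)) big_cons -/(resonator (rem p ps) r t).
have n0 := @one_minus_neq0 (r p) (ln (INR p) * t) hp.
have n1 := @one_minus_neq0 (r p) (- ln (INR p) * t) hp.
have e : Cminus (cis (- ln (INR p) * t)) (RtoC (r p)) =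
    Cmult (cis (- ln (INR p) * t)) (one_minus (r p) (ln (INR p) * t)).
  have := cis_mult_conj (ln (INR p) * t); rewrite Ropp_mult_distr_l /one_minus => h.
  transitivity (Cminus (cis (- ln (INR p) * t)) (Cmult (RtoC (r p))
    (Cmult (cis (ln (INR p) * t)) (cis (- ln (INR p) * t))))); first by rewrite h; ring.
  by ring.
by rewrite e /=; field.
Qed.

(** Completely multiplicative extension of r, with the value 1 at primes outside [ps]. *)
Definition mult_ext (ps : seq nat) (r : nat -> R) (n : nat) := \prod_(p <- ps) r p ^ logn p n.

Lemma mult_ext_mult_fun ps r : mult_fun (mult_ext ps r).
Proof.
split; first by rewrite /mult_ext big1 // => p _; rewrite logn1.
move=> m n m0 n0; rewrite /mult_ext -big_split; apply: eq_bigr => p _.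
by rewrite lognM // pow_add.
Qed.

Lemma mult_ext_prime ps r p : uniq ps -> prime p -> p \in ps -> mult_ext ps r p = r p.
Proof.
move=> ups pp pps; rewrite /mult_ext (bigD1_seq p) //= logn_prime // eqxx /= Rmult_1_r.
rewrite big1 ?Rmult_1_r // => q /negbTE qp.
by rewrite logn_prime // qp.
Qed.

Lemma mult_ext_ge0 ps r n : (forall p, p \in ps -> 0 <= r p < 1) -> 0 <= mult_ext ps r n.
Proof.
move=> hr; apply: (proj1 (prod_le (G := fun p => r p ^ logn p n) _)) => p /hr hp _.
by split; [apply: pow_le; lra|lra].
Qed.

Lemma dominates_smooth ps r n : uniq ps -> (forall p, p \in ps -> 0 <= r p < 1) -> (0 < n)%N ->
  (forall q, prime q -> q %| n -> q \in ps)%N ->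
  dominates (resonator ps r) (fun t => cis (- ln (INR n) * t)) (mult_ext ps r n).
Proof.
move=> ups hr; have [k] := ubnP n; elim: k n => // k ih n.
rewrite ltnS => nk n0 hn.
have [g1 gM] := mult_ext_mult_fun ps r.
have [n1|n1] := leqP n 1.
  have -> : n = 1%N by apply/eqP; rewrite eqn_leq n1.
  rewrite g1; apply: dominates_ext (dominates_const _ Rle_0_1) => t.
  by rewrite ln_1 Ropp_0 Rmult_0_l cis0.
have pp := pdiv_prime n1; case/dvdnP: (pdiv_dvd n) => m nE.
have m0 : (0 < m)%N by move: n0; rewrite nE muln_gt0 => /andP[].
have p0 := prime_gt0 pp.
have pps : pdiv n \in ps by apply: hn => //; exact: pdiv_dvd.
have e : mult_ext ps r n = mult_ext ps r m * r (pdiv n).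
  by rewrite {1}nE gM // (mult_ext_prime r ups pp pps).
rewrite e; apply: dominates_ext (dominates_mult (ih m _ m0 _) (dominates_prime ups hr pps)).
- move=> t; rewrite -cis_add.
  have -> : ln (INR n) = ln (INR m) + ln (INR (pdiv n)).
    by rewrite {1}nE INR_muln ln_mult //; exact: INR_gt0.
  by congr cis; ring.
- by apply: leq_trans nk; rewrite [X in (_ <= X)%N]nE ltn_Pmulr // prime_gt1.
- by move=> q qp qm; apply: hn => //; rewrite nE dvdn_mulr.
Qed.

Definition zsum N u : C :=
  \big[Cplus/RtoC 0]_(1 <= n < N.+1) Cmult (RtoC (/ INR n)) (cis (- ln (INR n) * u)).

(** Since n^(-ijt) is the j-th power of n^(-it), its average is at least r(n)^j. *)
Lemma dominates_zsum ps r N E j : uniq ps -> all prime ps -> (forall p, p \in ps -> 0 <= r p < 1) ->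
  dominates (resonator ps r) (fun t => zsum N (INR j * t))
    (\sum_(1 <= n < N.+1 | n \in smooth E ps) (/ INR n * mult_ext ps r n ^ j)).
Proof.
move=> ups hps hr; rewrite big_mkcond; apply: dominates_sum => n; rewrite mem_index_iota => /andP[n0 _].
have hi : 0 <= / INR n by left; apply: Rinv_0_lt_compat; exact: INR_gt0.
have hQ := pos_def_resonator hr.
(* An n outside the smooth list keeps only the bound 0. *)
case: ifP => hn; last first.
  rewrite -(Rmult_0_r (/ INR n)).
  apply: dominates_ext (dominates_mult (dominates_const _ hi) (dominates_char (- ln (INR n) * INR j) hQ)) => t.
  by rewrite Rmult_assoc.
apply: dominates_mult; first exact: dominates_const.
have h := @dominates_smooth ps r n ups hr n0 (fun q => smooth_primes hps hn).
elim: j => [|j ih].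
  by apply: dominates_ext (dominates_const _ Rle_0_1) => t; rewrite Rmult_0_l Rmult_0_r cis0.
apply: dominates_ext (dominates_mult h ih) => t.
by rewrite -cis_add S_INR; congr cis; ring.
Qed.

(** The pair of inequalities says |a - b| < D without truncated subtraction; such b lie in a window
    of length 2D. *)
Lemma count_near K a D : \sum_(0 <= b < K) (if (b < a + D)%N && (a < b + D)%N then 1 else 0) <= 2 * INR D.
Proof.
rewrite -big_mkcond -big_filter.
apply: (Rle_trans _ (\sum_(b <- iota (a - D) (D + D)) 1)); last first.
  by rewrite sum_const count_predT size_iota INR_addn; lra.
apply: sum_subset; [by apply: filter_uniq; exact: iota_uniq| |by move=> b _; lra].
move=> b; rewrite mem_filter => /andP[/andP[h1 h2] _].
rewrite mem_iota leq_subLR addnC (ltnW h2) /= addnA; apply: leq_trans h1 _.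
by rewrite leq_add2r addnC -leq_subLR.
Qed.

(** Write S for the Toeplitz sum. Then rho S(Q) <= S(Re Z Q) <= Y S(Q) + 2 D B M K, the last term
    covering the pairs with |a - b| < D. If rho > Y, dividing by S(Q) >= K^2 gives the claim. *)
Lemma resonance ps r Z rho K D Y B M : (forall p, p \in ps -> 0 <= r p < 1) ->
  dominates (resonator ps r) Z rho -> (0 < K)%N -> 0 <= Y ->
  (forall k, (D <= k < K)%N -> Cmod (Z (INR k)) <= Y /\ Cmod (Z (- INR k)) <= Y) ->
  (forall t, Cmod (Z t) <= B) -> (forall t, weight ps r t <= M) ->
  rho <= Y + 2 * INR D * B * M / INR K.
Proof.
move=> hr [_ [rho0 hZ]] K0 Y0 hY hB hM; have hK := INR_gt0 K0.
have hw t := weight_bounds t hr.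
have B0 : 0 <= B := Rle_trans _ _ _ (Cmod_ge_0 _) (hB 0).
have M0 : 0 <= M := Rle_trans _ _ _ (proj1 (hw 0)) (hM 0).
have D0 := pos_INR D.
have BM0 : 0 <= B * M by exact: Rmult_le_pos.
have h1 : rho * toeplitz K (weight ps r) <= toeplitz K (fun t => Re (Z t) * weight ps r t).
  have := toeplitz_pos_def K hZ.
  suff -> : toeplitz K (fun t => Re (Cmult (Cminus (Z t) (RtoC rho)) (resonator ps r t))) =
     toeplitz K (fun t => Re (Z t) * weight ps r t) + - rho * toeplitz K (weight ps r) by lra.
  rewrite -toeplitz_scale -toeplitz_add; apply: eq_bigr => a _; apply: eq_bigr => b _.
  by rewrite resonator_weight // /Re /=; ring.
have h2 : INR K ^ 2 <= toeplitz K (weight ps r).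
  have := toeplitz_pos_def K (pos_def_resonator_minus1 hr).
  suff -> : toeplitz K (fun t => Re (Cminus (resonator ps r t) (RtoC 1))) =
     toeplitz K (weight ps r) + toeplitz K (fun _ => - 1) by rewrite toeplitz_const; lra.
  rewrite -toeplitz_add; apply: eq_bigr => a _; apply: eq_bigr => b _.
  by rewrite resonator_weight // /Re /=; ring.
have h3 : toeplitz K (fun t => Re (Z t) * weight ps r t) <=
    Y * toeplitz K (weight ps r) + INR K * (B * M * (2 * INR D)).
  have -> : INR K * (B * M * (2 * INR D)) = \sum_(0 <= a < K) B * M * (2 * INR D).
    by rewrite sum_const count_predT size_iota subn0.
  rewrite -toeplitz_scale.
  rewrite /toeplitz -big_split; apply: sum_le => a; rewrite mem_index_iota => /andP[_ aK] _.
  apply: (Rle_trans _ (\sum_(0 <= b < K) (Y * weight ps r (INR a - INR b) +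
    B * M * (if (b < a + D)%N && (a < b + D)%N then 1 else 0)))); last first.
    rewrite big_split /=; apply: Rplus_le_compat_l; rewrite -big_distrr /=.
    by apply: Rmult_le_compat_l => //; exact: count_near.
  apply: sum_le => b; rewrite mem_index_iota => /andP[_ bK] _.
  set t := INR a - INR b; have [w0 _] := hw t.
  have hRe : Re (Z t) <= Cmod (Z t) := Rle_trans _ _ _ (Rle_abs _) (re_le_Cmod _).
  have hYw := Rmult_le_pos _ _ Y0 w0.
  case: ifP => hab.
    have : Re (Z t) * weight ps r t <= Cmod (Z t) * weight ps r t by exact: Rmult_le_compat_r.
    have : Cmod (Z t) * weight ps r t <= B * M by apply: Rmult_le_compat => //; exact: Cmod_ge_0.
    lra.
  rewrite Rmult_0_r Rplus_0_r; apply: Rmult_le_compat_r => //; apply: Rle_trans hRe _.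
  have [ab|/ltnW ba] := leqP a b.
    have -> : t = - INR (b - a) by rewrite /t -{1}(subnKC ab) INR_addn; ring.
    apply: (proj2 (hY _ _)); rewrite (leq_ltn_trans (leq_subr _ _) bK) andbT leqNgt.
    apply/negP => h; move: hab; rewrite -ltn_subLR // h /=.
    by rewrite (leq_ltn_trans ab) // -{1}(addn0 b) ltn_add2l; exact: leq_ltn_trans h.
  have -> : t = INR (a - b) by rewrite /t -{1}(subnKC ba) INR_addn; ring.
  apply: (proj1 (hY _ _)); rewrite (leq_ltn_trans (leq_subr _ _) aK) andbT leqNgt.
  apply/negP => h; move: hab; rewrite andbC -ltn_subLR // h /=.
  by rewrite (leq_ltn_trans ba) // -{1}(addn0 a) ltn_add2l; exact: leq_ltn_trans h.
have [hle|hlt] := Rle_lt_dec rho Y.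
  have : 0 <= 2 * INR D * B * M / INR K; last lra.
  by apply: Rdiv_le_0_compat => //; rewrite Rmult_assoc; apply: Rmult_le_pos; lra.
have h4 := Rmult_le_compat_l (rho - Y) _ _ ltac:(lra) h2.
have : rho - Y <= 2 * INR D * B * M / INR K; last lra.
apply/Rle_div_r => //; apply: (Rmult_le_reg_l (INR K)) => //.
by move: h1 h3 h4; rewrite /= Rmult_1_r; lra.
Qed.

(** * Proof of the lower bound *)

Lemma harm_le n : (0 < n)%N -> harm n <= 1 + ln (INR n).
Proof.
elim: n => // -[_ _|n ih _]; first by rewrite /harm big_nat1 Rinv_1 ln_1; lra.
have := ih isT; rewrite (harmS n.+1); have [h _] := ln_step (ltn0Sn n); lra.
Qed.

Lemma Cmod_sum (s : seq nat) (F : nat -> C) :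
  Cmod (\big[Cplus/RtoC 0]_(i <- s) F i) <= \sum_(i <- s) Cmod (F i).
Proof.
elim: s => [|i s ih]; first by rewrite !big_nil Cmod_0; lra.
rewrite !big_cons; apply: Rle_trans (Cmod_triangle _ _) _.
exact: Rplus_le_compat_l.
Qed.

Lemma Cmod_zsum_le N u : (0 < N)%N -> Cmod (zsum N u) <= 1 + ln (INR N).
Proof.
move=> N0; apply: Rle_trans (harm_le N0); apply: Rle_trans (Cmod_sum _ _) _.
apply: sum_le => n; rewrite mem_index_iota => /andP[n0 _] _.
rewrite Cmod_mult Cmod_cis Cmod_R Rmult_1_r Rabs_pos_eq; first lra.
by left; apply: Rinv_0_lt_compat; exact: INR_gt0.
Qed.

Lemma zsum_parts N u : zsum N u = (zpart_re N u, zpart_im N u).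
Proof.
rewrite /zsum /zpart_re /zpart_im.
elim: (index_iota 1 N.+1) => [|n s ih]; first by rewrite !big_nil.
rewrite !big_cons ih /cis -Ropp_mult_distr_l cos_neg sin_neg /Cplus /Cmult /RtoC /Rdiv /=.
by rewrite [ln _ * u]Rmult_comm; congr (_, _); ring.
Qed.

Lemma Cmod_zsum_opp N u : Cmod (zsum N (- u)) = Cmod (zsum N u).
Proof.
have -> : zsum N (- u) = Cconj (zsum N u); last by rewrite Cmod_conj.
rewrite !zsum_parts /Cconj /=; congr (_, _).
  by apply: eq_bigr => n _; rewrite -Ropp_mult_distr_l cos_neg.
rewrite /zpart_im (big_morph Ropp Ropp_plus_distr Ropp_0); apply: eq_bigr => n _.
by rewrite -Ropp_mult_distr_l sin_neg /Rdiv; ring.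
Qed.

Lemma Cmod_le_abs x y : Cmod (x, y) <= Rabs x + Rabs y.
Proof.
have -> : (x, y) = Cplus (RtoC x) (Cmult Ci (RtoC y)).
  by rewrite /Cplus /Cmult /RtoC /Ci /=; congr (_, _); ring.
apply: Rle_trans (Cmod_triangle _ _) _.
by rewrite Cmod_mult Cmod_Ci !Cmod_R; lra.
Qed.

Lemma zsum_approx u N : 0 < u ->
  Rabs (Cmod (zsum N.+1 u) - zeta1_abs u) <= 2 * (/ u + 2 * (u + 1) / INR N.+1).
Proof.
move=> u0; change (zeta1_abs u) with (Cmod (zeta1_re u, zeta1_im u)); rewrite zsum_parts.
set z := (zpart_re _ _, _); set w := (zeta1_re u, _).
have h : Cmod (Cminus w z) <= 2 * (/ u + 2 * (u + 1) / INR N.+1).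
  apply: Rle_trans (Cmod_le_abs _ _) _ => /=; rewrite -/(INR N.+1).
  by have := zeta1_re_approx N u0; have := zeta1_im_approx N u0; rewrite /Rminus; lra.
have h1 := Cmod_triangle z (Cminus w z); have h2 := Cmod_triangle w (Copp (Cminus w z)).
have e1 : Cplus z (Cminus w z) = w by ring.
have e2 : Cplus w (Copp (Cminus w z)) = z by ring.
rewrite e1 in h1; rewrite e2 Cmod_opp in h2.
by apply/Rabs_le_between; lra.
Qed.

(** The factors are exchanged one at a time, each exchange costing at most d times the remaining
    factors, which are bounded by B. *)
Lemma prod_perturb (s : seq nat) (a b : nat -> R) d B : 1 <= B -> 0 <= d ->
  (forall j, j \in s -> 0 <= a j <= B /\ 0 <= b j <= B /\ a j <= b j + d) ->
  \prod_(j <- s) a j <= \prod_(j <- s) b j + INR (size s) * d * B ^ size s.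
Proof.
move=> B1 d0.
suff h s' : {subset s' <= s} -> (forall j, j \in s -> 0 <= a j <= B /\ 0 <= b j <= B /\ a j <= b j + d) ->
  0 <= \prod_(j <- s') a j <= B ^ size s' /\
  \prod_(j <- s') a j <= \prod_(j <- s') b j + INR (size s') * d * B ^ size s'.
  by move=> hs; exact: (proj2 (h s (fun _ => id) hs)).
move=> hs h; elim: s' hs => [_|j s' ih hs].
  by rewrite !big_nil /=; split; lra.
have [[p0 p1] p2] := ih (fun i hi => hs i (mem_behead (s := j :: s') hi)).
have [ha [hb hab]] := h j (hs j (mem_head _ _)).
have pB : 1 <= B ^ size s' by exact: pow_R1_Rle.
rewrite !big_cons -[size (j :: s')]/(size s').+1 S_INR -[B ^ _.+1]/(B * B ^ size s').
split; first by split; [apply: Rmult_le_pos; lra|apply: Rmult_le_compat; lra].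
set P := \prod_(j <- s') a j in p0 p1 p2 *; set Q := \prod_(j <- s') b j in p2 *.
have n0 := pos_INR (size s').
have q1 : a j * P <= b j * P + d * P by rewrite -Rmult_plus_distr_r; apply: Rmult_le_compat_r; lra.
have q2 : d * P <= d * (B * B ^ size s').
  by apply: Rmult_le_compat_l => //; nra.
have q3 : b j * P <= b j * Q + b j * (INR (size s') * d * B ^ size s').
  by rewrite -Rmult_plus_distr_l; apply: Rmult_le_compat_l; lra.
have q4 : b j * (INR (size s') * d * B ^ size s') <= B * (INR (size s') * d * B ^ size s').
  apply: Rmult_le_compat_r; last lra.
  by apply: Rmult_le_pos; [exact: Rmult_le_pos|lra].
lra.
Qed.

(** By Bernoulli q >= 1/p - j/x, where p has cancelled; 1 - 1/p >= 1/2 doubles this into 2j/x. The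
    further 1/x pays for truncating the series, since q^(E+1) <= 2^(-E-1) <= 1/(2x). *)
Lemma geom_sum_ln_ge p x j E : (0 < p)%N -> (p <= x)%N -> prime p -> (x <= 2 ^ E)%N ->
  - ln (1 - / INR p) - (2 * INR j + 1) / INR x <=
  ln (\sum_(0 <= e < E.+1) (/ INR p * (1 - INR p / INR x) ^ j) ^ e).
Proof.
move=> p0 px pp xE.
have hp := prime_INR_ge2 pp; have hpx := leq_INR px; have ip := inv_prime pp.
set r := 1 - INR p / INR x; set q := / INR p * r ^ j.
have x0 : 0 < INR x by lra.
have hr : 0 <= INR p / INR x <= 1.
  by split; [apply: Rdiv_le_0_compat; lra|apply/Rle_div_l; lra].
have hrj : 1 - INR j * (INR p / INR x) <= r ^ j <= 1.
  split; first exact: bernoulli.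
  by have := pow_incr r 1 j; rewrite pow1 /r; lra.
have rj0 : 0 <= r ^ j by apply: pow_le; rewrite /r; lra.
have hq : 0 <= q <= / 2 by rewrite /q; split; [apply: Rmult_le_pos; lra|nra].
have j0 := pos_INR j.
have hqE : q ^ E.+1 <= / (2 * INR x).
  apply: (Rle_trans _ ((/ 2) ^ E.+1)); first by apply: pow_incr; lra.
  rewrite pow_inv; apply: Rinv_le_contravar; first lra.
  by have := leq_INR xE; rewrite INR_expn (_ : INR 2 = 2) //=; lra.
have q0 : 0 <= q ^ E.+1 by apply: pow_le; lra.
have ix : 0 < / INR x <= / 2.
  by split; [exact: Rinv_0_lt_compat|apply: Rinv_le_contravar; lra].
have eix : / (2 * INR x) = / INR x / 2 by field; lra.
have -> : \sum_(0 <= e < E.+1) q ^ e = (1 - q ^ E.+1) / (1 - q).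
  by rewrite -(geom_sum q E.+1); field; lra.
rewrite ln_div; [|lra|lra].
have h1 := @ln_one_minus_ge (q ^ E.+1) ltac:(lra).
have h2 : ln (1 - q) <= ln (1 - / INR p) + 2 * INR j / INR x.
  have jx : 0 <= INR j / INR x by apply: Rdiv_le_0_compat.
  have h3 : 1 - q <= (1 - / INR p) * (1 + 2 * (INR j / INR x)).
    have : / INR p - INR j / INR x <= q.
      rewrite /q; have := Rmult_le_compat_l (/ INR p) _ _ ltac:(lra) (proj1 hrj).
      have -> : / INR p * (1 - INR j * (INR p / INR x)) = / INR p - INR j / INR x by field; lra.
      lra.
    nra.
  apply: Rle_trans (ln_le _ _ _ h3) _; first lra.
  rewrite ln_mult; [|lra|lra].
  by have := @ln_le_sub1 (1 + 2 * (INR j / INR x)); rewrite /Rdiv; lra.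
have -> : (2 * INR j + 1) / INR x = 2 * INR j / INR x + / INR x by field; lra.
lra.
Qed.

Definition res_coef x p := 1 - INR p / INR x.

Lemma res_coef_bounds x p : (0 < p)%N -> (p <= x)%N -> 0 <= res_coef x p < 1.
Proof.
move=> p0 px; have hp := INR_gt0 p0; have h := leq_INR px; rewrite /res_coef.
have : 0 < INR p / INR x <= 1; last lra.
by split; [apply: Rdiv_lt_0_compat; lra|apply/Rle_div_l; lra].
Qed.

Lemma sum_primes_const x c : 0 <= c -> (1 < x)%N ->
  \sum_(p <- primes_upto x) c <= 24 * c * (INR x / ln (INR x)).
Proof.
move=> c0 x1; have := prime_log_weight_le x1; rewrite -sum_primes_upto => h.
have : \sum_(p <- primes_upto x) 1 <= \sum_(p <- primes_upto x) (1 + (ln (INR x) - ln (INR p))).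
  apply: sum_le => p; rewrite mem_primes_upto => /andP[pp px] _.
  by have := ln_INR_le (prime_gt0 pp) px; lra.
rewrite !sum_const; nra.
Qed.

(** 6 from [mertens_lower], and 24 (2l + 1) from a loss of (2l + 1)/x at each of the at most 24 x /
    log x primes. *)
Definition mertens_loss l := 6 + 24 * (2 * INR l + 1).

(** The cap E = x is ample because x <= 2^x. Exponentiating, the loss c / log x becomes a factor at
    least 1 - c / log x, that is, an additive constant beside log x. *)
Lemma truncated_sum_ge l j x N : (1 < x)%N -> (j <= l)%N -> (x ^ (x * x) <= N)%N ->
  exp euler_gamma * (ln (INR x) - mertens_loss l) <=
  \sum_(1 <= n < N.+1 | n \in smooth x (primes_upto x))
    (/ INR n * mult_ext (primes_upto x) (res_coef x) n ^ j).
Proof.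
move=> x1 jl hN; have x0 : (0 < x)%N by exact: ltnW.
set ps := primes_upto x; set rho := mult_ext ps (res_coef x).
have hps p : p \in ps -> prime p /\ (p <= x)%N by rewrite mem_primes_upto => /andP.
have hr p : p \in ps -> 0 <= res_coef x p < 1.
  by move=> /hps [pp px]; apply: res_coef_bounds => //; exact: prime_gt0.
have [rho1 rhoM] := mult_ext_mult_fun ps (res_coef x).
pose g n := / INR n * rho n ^ j.
have hg : mult_fun g.
  split; first by rewrite /g /rho rho1 pow1 /= Rinv_1; ring.
  move=> m n m0 n0; rewrite /g /rho rhoM // Rpow_mult_distr INR_muln Rinv_mult; ring.
have g0 k : 0 <= g k.
  apply: Rmult_le_pos; last by apply: pow_le; exact: mult_ext_ge0.
  case: k => [|k]; first by rewrite Rinv_0; lra.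
  by left; apply: Rinv_0_lt_compat; exact: INR_gt0.
apply: Rle_trans (sum_ge_euler_product hg g0 x0 hN).
have lx := ln_INR_gt0 x1; have hx := INR_gt0 x0.
set V := \prod_(p <- _) _.
have pos p : p \in ps -> 0 < \sum_(0 <= e < x.+1) g p ^ e.
  move=> _; rewrite big_nat_recl //=.
  have : 0 <= \sum_(0 <= e < x) (g p * g p ^ e); last by move=> h; lra.
  by apply: sum_ge0 => e _ _; apply: Rmult_le_pos; [exact: g0|apply: pow_le; exact: g0].
have V0 : 0 < V by apply: prod_gt0 => p hp _; exact: pos.
have lnV : ln (ln (INR x)) + euler_gamma - mertens_loss l / ln (INR x) <= ln V.
  rewrite ln_prod; last by move=> p hp _; exact: pos.
  have h1 := mertens_lower x1; rewrite /neg_ln_euler -sum_primes_upto in h1.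
  have c0 : 0 <= (2 * INR l + 1) / INR x.
    by apply: Rdiv_le_0_compat => //; have := pos_INR l; lra.
  have h2 := sum_primes_const c0 x1.
  have e : 24 * ((2 * INR l + 1) / INR x) * (INR x / ln (INR x)) =
    24 * (2 * INR l + 1) / ln (INR x) by field; lra.
  rewrite e in h2.
  have h3 : \sum_(p <- ps) - ln (1 - / INR p) <=
     \sum_(p <- ps) (ln (\sum_(0 <= e < x.+1) g p ^ e) + (2 * INR l + 1) / INR x).
    apply: sum_le => p hp _; have [pp px] := hps p hp.
    have := @geom_sum_ln_ge p x j x (prime_gt0 pp) px pp (ltnW (ltn_expl x (ltnSn 1))).
    rewrite /g /rho (mult_ext_prime _ (primes_upto_uniq x) pp hp) -/(res_coef x p).
    have : (2 * INR j + 1) / INR x <= (2 * INR l + 1) / INR x; last lra.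
    apply: Rmult_le_compat_r; first by left; exact: Rinv_0_lt_compat.
    by have := leq_INR jl; lra.
  rewrite big_split /= in h3.
  apply: (Rplus_le_reg_r (24 * (2 * INR l + 1) / ln (INR x))).
  apply: Rle_trans (Rle_trans _ _ _ h1 (Rle_trans _ _ _ h3 (Rplus_le_compat_l _ _ _ h2))).
  by rewrite /mertens_loss Rdiv_plus_distr; lra.
rewrite -(exp_ln V) //; apply: Rle_trans (exp_mono lnV).
have -> : ln (ln (INR x)) + euler_gamma - mertens_loss l / ln (INR x) =
  euler_gamma + (ln (ln (INR x)) + - (mertens_loss l / ln (INR x))) by ring.
rewrite !exp_plus exp_ln //; apply: Rmult_le_compat_l; first exact: Rlt_le (exp_pos _).
have h := exp_ineq1_le (- (mertens_loss l / ln (INR x))).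
have := Rmult_le_compat_l _ _ _ (Rlt_le _ _ lx) h.
have -> : ln (INR x) * (1 + - (mertens_loss l / ln (INR x))) = ln (INR x) - mertens_loss l by field; lra.
lra.
Qed.

(** Since 1 - r(p) = p/x, the logarithm of the maximum is 2 sum log(x/p). *)
Lemma res_weight_le x t : (1 < x)%N ->
  weight (primes_upto x) (res_coef x) t <= exp (48 * (INR x / ln (INR x))).
Proof.
move=> x1; have x0 := INR_gt0 (ltnW x1).
have hr p : p \in primes_upto x -> 0 <= res_coef x p < 1.
  by rewrite mem_primes_upto => /andP[/prime_gt0]; exact: res_coef_bounds.
apply: Rle_trans (proj2 (weight_bounds t hr)) _.
have pos p : p \in primes_upto x -> 0 < / (1 - res_coef x p) ^ 2.
  by move=> /hr h; apply: Rinv_0_lt_compat; apply: pow_lt; lra.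
rewrite -(exp_ln (\prod_(p <- _) _)); last by apply: prod_gt0 => p hp _; exact: pos.
apply: exp_mono; rewrite ln_prod; last by move=> p hp _; exact: pos.
have := prime_log_weight_le x1; rewrite -sum_primes_upto => h.
apply: (Rle_trans _ (2 * \sum_(p <- primes_upto x) (1 + (ln (INR x) - ln (INR p))))); last lra.
rewrite big_distrr /=; apply: sum_le => p; rewrite mem_primes_upto => /andP[pp px] _.
have p0 := INR_gt0 (prime_gt0 pp).
have -> : / (1 - res_coef x p) ^ 2 = (INR x / INR p) ^ 2 by rewrite /res_coef; field; lra.
rewrite ln_pow; last by apply: Rdiv_lt_0_compat.
by rewrite ln_div //=; lra.
Qed.

Lemma exp_INR_mult n x : exp (INR n * x) = exp x ^ n.
Proof.
elim: n => [|n ih]; first by rewrite Rmult_0_l exp_0.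
by rewrite S_INR Rmult_plus_distr_r Rmult_1_l exp_plus ih Rmult_comm.
Qed.

Lemma pow_prod_le (l : nat) (c : R) (V : nat -> R) : 0 <= c ->
  (forall j, (1 <= j < l.+1)%N -> c <= V j) -> c ^ l <= \prod_(1 <= j < l.+1) V j.
Proof.
move=> c0 h.
have -> : c ^ l = \prod_(1 <= j < l.+1) c.
  elim: l {h} => [|l ih]; first by rewrite big_geq.
  by rewrite big_nat_recr //= -ih Rmult_comm.
by apply: (proj2 (prod_le _)) => j; rewrite mem_index_iota => hj _; split => //; exact: h.
Qed.

Lemma resonance_zeta_sums l x N K D Y : (1 < x)%N -> (x ^ (x * x) <= N)%N ->
  mertens_loss l <= ln (INR x) -> (0 < K)%N -> 0 <= Y ->
  (forall k, (D <= k < K)%N -> \prod_(1 <= j < l.+1) Cmod (zsum N (INR j * INR k)) <= Y) ->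
  exp (INR l * euler_gamma) * (ln (INR x) - mertens_loss l) ^ l <=
  Y + 2 * INR D * (1 + ln (INR N)) ^ l * exp (48 * (INR x / ln (INR x))) / INR K.
Proof.
move=> x1 hN hx K0 Y0 hY.
have N0 : (0 < N)%N by apply: leq_trans hN; rewrite expn_gt0 ltnW.
have hr p : p \in primes_upto x -> 0 <= res_coef x p < 1.
  by rewrite mem_primes_upto => /andP[/prime_gt0]; exact: res_coef_bounds.
pose Z t := \big[Cmult/RtoC 1]_(1 <= j < l.+1) zsum N (INR j * t).
pose V j := \sum_(1 <= n < N.+1 | n \in smooth x (primes_upto x))
    (/ INR n * mult_ext (primes_upto x) (res_coef x) n ^ j).
have hZ t : Cmod (Z t) = \prod_(1 <= j < l.+1) Cmod (zsum N (INR j * t)).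
  by rewrite /Z (big_morph Cmod Cmod_mult Cmod_1).
have hdom : dominates (resonator (primes_upto x) (res_coef x)) Z (\prod_(1 <= j < l.+1) V j).
  apply: dominates_prod => j _.
  exact: (dominates_zsum N x j (primes_upto_uniq x) (primes_upto_prime x) hr).
apply: (Rle_trans _ (\prod_(1 <= j < l.+1) V j)).
  rewrite exp_INR_mult -Rpow_mult_distr; apply: pow_prod_le.
    by apply: Rmult_le_pos; [exact: Rlt_le (exp_pos _)|lra].
  by move=> j /andP[_ jl]; exact: truncated_sum_ge.
apply: (resonance hr hdom K0 Y0) => [k hk|t|t]; last exact: res_weight_le.
  rewrite !hZ; split; first exact: hY.
  rewrite (eq_bigr (fun j => Cmod (zsum N (INR j * INR k)))) => [|j _]; first exact: hY.
  by rewrite -Ropp_mult_distr_r Cmod_zsum_opp.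
rewrite hZ.
have -> : (1 + ln (INR N)) ^ l = \prod_(1 <= j < l.+1) (1 + ln (INR N)).
  elim: (l) => [|m ih]; first by rewrite big_geq.
  by rewrite big_nat_recr //= -ih Rmult_comm.
apply: (proj2 (prod_le _)) => j _ _; split; [exact: Cmod_ge_0|exact: Cmod_zsum_le].
Qed.

Lemma prodR_prod (f : nat -> R) l : prodR f l = \prod_(1 <= j < l.+1) f j.
Proof. by elim: l => [|l ih] /=; [rewrite big_geq|rewrite ih [in RHS]big_nat_recr]. Qed.

Lemma pow_add_ge l a b : 0 <= a -> 0 <= b ->
  a ^ l.+1 + INR l.+1 * a ^ l * b <= (a + b) ^ l.+1.
Proof.
move=> a0 b0; elim: l => [|l ih]; first by rewrite /=; lra.
have h1 := Rmult_le_compat_l (a + b) _ _ ltac:(lra) ih.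
have n0 := pos_INR l.+1; have p0 := pow_le a l a0.
rewrite -[(a + b) ^ l.+2]/((a + b) * (a + b) ^ l.+1); apply: Rle_trans h1.
have : 0 <= INR l.+1 * a ^ l * b * b by do 3 (apply: Rmult_le_pos => //).
rewrite (S_INR l.+1) -[a ^ l.+2]/(a * (a * a ^ l)) -[a ^ l.+1]/(a * a ^ l); lra.
Qed.

(** With c = 4(m+1), e^(L/4) = (e^(L/c))^(m+1) >= (L/c)^(m+1), one power of L more than required. *)
Lemma exp_dominates_pow A m : 0 <= A ->
  exists L0, forall L, L0 <= L -> 1 <= L -> A * L ^ m <= exp (L / 4).
Proof.
move=> A0; have c0 := INR_gt0 (ltn0Sn m); set c := 4 * INR m.+1.
exists (A * c ^ m.+1) => L hL L1.
have cp : 0 < c ^ m.+1 by apply: pow_lt; rewrite /c; lra.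
have -> : L / 4 = INR m.+1 * (L / c) by rewrite /c; field; lra.
rewrite exp_INR_mult; apply: (Rle_trans _ ((L / c) ^ m.+1)); last first.
  apply: pow_incr; split; first by apply: Rdiv_le_0_compat; rewrite /c; lra.
  by have := exp_ineq1_le (L / c); lra.
rewrite /Rdiv Rpow_mult_distr pow_inv.
apply: (Rmult_le_reg_r (c ^ m.+1)) => //.
rewrite [X in _ <= X]Rmult_assoc Rinv_l ?Rmult_1_r; last exact: Rgt_not_eq.
rewrite -[L ^ m.+1]/(L * L ^ m).
have Lm : 0 <= L ^ m by apply: pow_le; lra.
by have := Rmult_le_compat_r _ _ _ Lm hL; lra.
Qed.

Lemma zeta_sum_product_le l N k B d : (0 < l)%N -> (0 < N)%N -> (0 < k)%N -> 0 <= d ->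
  1 + ln (INR N) + d <= B ->
  2 * (/ INR k + 2 * (INR l * INR k + 1) / INR N) <= d ->
  \prod_(1 <= j < l.+1) Cmod (zsum N (INR j * INR k)) <=
  prodR (fun j => zeta1_abs (INR j * INR k)) l + INR l * d * B ^ l.
Proof.
move=> l0 N0 k0 d0 hB hd; rewrite prodR_prod.
have hN := INR_gt0 N0; have hk := INR_gt0 k0.
have lN := ln_INR_ge0 N0.
have := @prod_perturb (index_iota 1 l.+1) (fun j => Cmod (zsum N (INR j * INR k)))
  (fun j => zeta1_abs (INR j * INR k)) d B.
rewrite size_iota subSS subn0; apply => //; first lra.
move=> j; rewrite mem_index_iota ltnS => /andP[j0 jl].
have hj := INR_ge1 j0; have hjl := leq_INR jl.
have u0 : INR k <= INR j * INR k <= INR l * INR k by split; nra.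
have up : 0 < INR j * INR k by lra.
have := zsum_approx N.-1 up; rewrite prednK //.
move=> /Rabs_le_between h.
have h2 : 2 * (/ (INR j * INR k) + 2 * (INR j * INR k + 1) / INR N) <= d.
  apply: Rle_trans hd; apply: Rmult_le_compat_l; first lra.
  apply: Rplus_le_compat; first by apply: Rinv_le_contravar; lra.
  apply: Rmult_le_compat_r; first by left; apply: Rinv_0_lt_compat.
  lra.
have h3 := Cmod_zsum_le (INR j * INR k) N0.
have h4 := Cmod_ge_0 (zsum N (INR j * INR k)).
have h5 : 0 <= zeta1_abs (INR j * INR k) by exact: sqrt_pos.
lra.
Qed.

Lemma nat_floor y : 0 <= y -> exists n, INR n <= y < INR n + 1.
Proof. by move=> hy; have [n hn] := nfloor_ex y hy; exists n. Qed.

(* [ln] is [0] on nonpositive arguments. *)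
Lemma ln_gt0_inv x : 0 < ln x -> 0 < x.
Proof. by rewrite /ln; case: Rlt_dec => // _; lra. Qed.

(* The length [x] of the resonator is chosen so that [exp (48 x / ln x) <= T^(1/4)]. *)
Lemma resonator_length L : 384 <= ln L -> exists x : nat, (1 < x)%N /\
  INR x <= L * L /\ ln L + ln (ln L) - ln 384 <= ln (INR x) /\
  48 * (INR x / ln (INR x)) <= L / 4.
Proof.
move=> ha; set a := ln L in ha *.
have L0 : 0 < L by apply: ln_gt0_inv; rewrite -/a; lra.
have aL : a <= L - 1 by exact: ln_le_sub1.
(* 192 = 4 * 48 makes 48 y / a = L / 4. Rounding down at most halves y, hence 384; and 384 <= a
   yields log x >= a. *)
pose y := L * a / 192.
have y2 : 2 <= y by rewrite /y; nra.
have [x [xy yx]] := nat_floor (ltac:(lra) : 0 <= y).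
have x1 : (1 < x)%N by apply/ltP; apply: INR_lt; rewrite /=; lra.
exists x; split => //; split; first by rewrite /y in xy; nra.
have ll : ln 384 <= ln a by apply: ln_le; lra.
have e : ln (y / 2) = a + ln a - ln 384.
  have -> : y / 2 = L * (a / 384) by rewrite /y; field.
  rewrite ln_mult; [|lra|by apply: Rdiv_lt_0_compat; lra].
  rewrite ln_div; [|lra|lra].
  by rewrite /a; lra.
have hx : a + ln a - ln 384 <= ln (INR x) by rewrite -e; apply: ln_le; lra.
split => //.
apply: (Rle_trans _ (48 * (y / a))); last by right; rewrite /y; field; lra.
apply: Rmult_le_compat_l; first lra.
apply: Rmult_le_compat; [exact: pos_INR|left; apply: Rinv_0_lt_compat; lra|exact: xy|].
by apply: Rinv_le_contravar; lra.
Qed.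

(** A Dirichlet sum of length exponential in x^2 log x is affordable because it enters only through
    its logarithm, a power of L = log T. *)
Lemma truncation_length L x K : 4 <= L -> INR x <= L * L -> (1 < x)%N -> (0 < K)%N ->
  ln (INR K) <= L -> 2 + ln (INR (x ^ (x * x) + K * K)) <= L ^ 7.
Proof.
move=> L4 xL x1 K0 hK.
have K1 := INR_ge1 K0; have x2 : 1 <= INR x by apply: INR_ge1; exact: ltnW.
have p1 : 1 <= INR (x ^ (x * x)) by apply: INR_ge1; rewrite expn_gt0 ltnW.
have p2 : 1 <= INR (K * K) by apply: INR_ge1; rewrite muln_gt0 K0.
have h1 : ln (INR (x ^ (x * x) + K * K)) <= ln (2 * (INR (x ^ (x * x)) * INR (K * K))).
  by apply: ln_le; rewrite INR_addn; nra.
rewrite ln_mult in h1; [|lra|nra].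
rewrite ln_mult in h1; [|lra|lra].
rewrite (INR_muln K) ln_mult in h1; [|lra|lra].
rewrite INR_expn ln_pow in h1; last lra.
rewrite INR_muln in h1.
have l2 : ln 2 <= 1 by have := @ln_le_sub1 2; lra.
have lx : 0 <= ln (INR x) <= INR x.
  by split; [apply: ln_INR_ge0; exact: ltnW|have := @ln_le_sub1 (INR x); lra].
have h2 : INR x * INR x * ln (INR x) <= (L * L) * (L * L) * (L * L).
  by apply: Rmult_le_compat; [nra|lra|apply: Rmult_le_compat; lra|lra].
have e6 : (L * L) * (L * L) * (L * L) = L ^ 6 by ring.
have e7 : L ^ 7 = L * L ^ 6 by ring.
have p6 : L <= L ^ 6.
  rewrite -{1}(Rmult_1_r L) -[L ^ 6]/(L * L ^ 5).
  by apply: Rmult_le_compat_l; [lra|apply: pow_R1_Rle; lra].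
rewrite e7; nra.
Qed.

Lemma large_values l : (0 < l)%N ->
  exists C T0 : R, 0 < C /\
    forall T : R, T0 <= T ->
      exists t : R, sqrt T <= t <= T /\
        prodR (fun j => zeta1_abs (INR j * t)) l >=
        exp (INR l * euler_gamma) *
          ( ln (ln T) ^ l
            + INR l * ln (ln T) ^ (l - 1) * ln (ln (ln T))
            - C * ln (ln T) ^ (l - 1) ).
Proof.
move=> l0.
have hl := INR_ge1 l0.
set eg := exp (INR l * euler_gamma); have eg0 : 0 < eg by exact: exp_pos.
set ml := mertens_loss l; have ml0 : 0 < ml by rewrite /ml /mertens_loss; lra.
have l384 : 0 < ln 384 by rewrite -ln_1; apply: ln_increasing; lra.
set c2 := ml + ln 384.
(* The first part pays for log x falling short of a + log a; the 3 exceeds the two errors of size at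
   most 1, from passing to zeta and from small t. *)
pose C := INR l * c2 + 3 / eg.
set A := (18 + 16 * INR l) * (INR l + 1).
have A0 : 0 <= A by apply: Rmult_le_pos; lra.
have [L0 hL0] := exp_dominates_pow (7 * l) A0.
(* 384 is required for the resonator length; log a >= c2 makes the increment log a - c2 nonnegative
   in the binomial bound. *)
pose a0 := Rmax 384 (exp c2).
exists C, (exp (Rmax L0 (exp a0))); split.
  have : 0 < 3 / eg by apply: Rdiv_lt_0_compat; lra.
  have : 0 < INR l * c2 by apply: Rmult_lt_0_compat; rewrite /c2; lra.
  rewrite /C; lra.
move=> T hT.
have T0 : 0 < T by have := exp_pos (Rmax L0 (exp a0)); lra.
set L := ln T.
have hL : Rmax L0 (exp a0) <= L by rewrite -(ln_exp (Rmax _ _)); apply: ln_le => //; exact: exp_pos.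
have hL1 := Rle_trans _ _ _ (Rmax_l _ _) hL; have hL2 := Rle_trans _ _ _ (Rmax_r _ _) hL.
have {}hL2 : a0 <= ln L by rewrite -(ln_exp a0); apply: ln_le => //; exact: exp_pos.
set a := ln L in hL2 *.
have ha1 : 384 <= a := Rle_trans _ _ _ (Rmax_l _ _) hL2.
have ha2 : c2 <= ln a.
  rewrite -(ln_exp c2); apply: ln_le; first exact: exp_pos.
  exact: Rle_trans _ _ _ (Rmax_r _ _) hL2.
have [x [x1 [xL [hx hxw]]]] := resonator_length ha1; rewrite -/a in hx.
have Lpos : 0 < L by apply: ln_gt0_inv; rewrite -/a; lra.
have aL : a <= L - 1 by exact: ln_le_sub1.
(* S = T^(1/4) is the unit of size: sqrt T = S^2, and the resonator is at most S. *)
pose S := exp (L / 4).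
have hS : A * L ^ (7 * l) <= S by apply: hL0 => //; lra.
have TS : T = S ^ 4.
  rewrite -exp_INR_mult (_ : INR 4 * (L / 4) = L); last by rewrite /=; field.
  by rewrite /L exp_ln.
have S0 : 0 < S by exact: exp_pos.
have BL : 1 <= L ^ (7 * l) by apply: pow_R1_Rle; lra.
have A18 : 18 + 16 * INR l <= A by rewrite /A; nra.
have S18 : 18 + 16 * INR l <= S by nra.
have sT : sqrt T = S ^ 2.
  by rewrite TS (_ : S ^ 4 = S ^ 2 * S ^ 2); [apply: sqrt_square; nra|ring].
have S2 : 34 * S <= S ^ 2 by nra.
have S4 : 34 * S ^ 2 <= S ^ 4 by rewrite (_ : S ^ 4 = S ^ 2 * S ^ 2); [nra|ring].
have [K [K1 K2]] := nat_floor (Rlt_le _ _ T0).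
(* D is the floor of sqrt T, so integers k >= D + 1 lie beyond sqrt T; this is why D + 1 is the
   cutoff below. *)
have [D [D1 D2]] := nat_floor (ltac:(nra) : 0 <= S ^ 2).
have K0 : (0 < K)%N by apply/ltP; apply: INR_lt; rewrite /=; lra.
(* The first summand lets all smooth numbers into the sum; the second makes the approximation error
   for zeta of order 1/T when t <= T. *)
pose N := (x ^ (x * x) + K * K)%N.
have N0 : (0 < N)%N by rewrite /N addn_gt0 expn_gt0 ltnW.
have hN := truncation_length (ltac:(lra) : 4 <= L) xL x1 K0
  (ln_le _ _ (INR_gt0 K0) K1); rewrite -/N in hN.
(* Denying the conclusion supplies the upper bound on the zeta products that [resonance_zeta_sums]
   takes as hypothesis. *)
apply: NNPP => hno.
set target := eg * (a ^ l + INR l * a ^ (l - 1) * ln a - C * a ^ (l - 1)).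
have hlt t : sqrt T <= t <= T -> prodR (fun j => zeta1_abs (INR j * t)) l < target.
  by move=> ht; apply: Rnot_ge_lt => hge; apply: hno; exists t.
have target0 : 0 <= target.
  apply: Rle_trans (Rlt_le _ _ (hlt T _)); last by rewrite sT TS; lra.
  rewrite prodR_prod; apply: (proj1 (prod_le (G := fun j => zeta1_abs (INR j * T)) _)) => j _ _.
  by split; [exact: sqrt_pos|lra].
(* 18 + 16 l = 2 (1 + 8 (l + 1)): the 1/u term and the tail term of the approximation to zeta,
   doubled for the two coordinates. *)
pose d := (18 + 16 * INR l) / S ^ 2.
have d0 : 0 <= d by apply: Rdiv_le_0_compat; nra.
have d1 : d <= 1 by apply/Rle_div_l; nra.
have KT : T / 2 <= INR K by lra.
have small : INR l * d * (L ^ 7) ^ l <= 1.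
  rewrite -pow_mult (_ : (7 * l)%coq_nat = (7 * l)%N) // /d.
  have -> : INR l * ((18 + 16 * INR l) / S ^ 2) * L ^ (7 * l) =
    INR l * (18 + 16 * INR l) * L ^ (7 * l) / S ^ 2 by field; lra.
  apply/Rle_div_l; first nra.
  have : INR l * (18 + 16 * INR l) * L ^ (7 * l) <= A * L ^ (7 * l).
    by apply: Rmult_le_compat_r; [lra|rewrite /A; nra].
  lra.
have hY k : (D.+1 <= k < K)%N ->
    \prod_(1 <= j < l.+1) Cmod (zsum N (INR j * INR k)) <= target + 1.
  move=> /andP[k1 k2]; have hk1 := leq_INR k1; have hk2 := ltn_INR k2; rewrite S_INR in hk1.
  have kpos : (0 < k)%N by apply: leq_trans k1.
  have ht : sqrt T <= INR k <= T by rewrite sT; lra.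
  have := hlt _ ht.
  have := @zeta_sum_product_le l N k (L ^ 7) d l0 N0 kpos d0 ltac:(lra).
  suff hd : 2 * (/ INR k + 2 * (INR l * INR k + 1) / INR N) <= d by move=> /(_ hd); lra.
  have hNK : T ^ 2 / 4 <= INR N.
    have : INR K * INR K <= INR N by rewrite -INR_muln; apply: leq_INR; exact: leq_addl.
    nra.
  have h1 : / INR k <= / S ^ 2 by apply: Rinv_le_contravar; nra.
  have h2 : 2 * (INR l * INR k + 1) / INR N <= 8 * (INR l + 1) / S ^ 2.
    apply: (Rle_trans _ (2 * (INR l * T + T) / (T ^ 2 / 4))).
      apply: Rmult_le_compat; [nra|left; apply: Rinv_0_lt_compat; nra|nra|].
      by apply: Rinv_le_contravar; nra.
    have -> : 2 * (INR l * T + T) / (T ^ 2 / 4) = 8 * (INR l + 1) / T by field; lra.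
    apply: Rmult_le_compat_l; first lra.
    by apply: Rinv_le_contravar; nra.
  have -> : d = 2 * (/ S ^ 2 + 8 * (INR l + 1) / S ^ 2) by rewrite /d; field; lra.
  lra.
have mlx : ml <= ln (INR x) by rewrite /c2 in ha2; lra.
have := resonance_zeta_sums x1 (leq_addr _ _ : (x ^ (x * x) <= N)%N) mlx K0
  (ltac:(lra) : 0 <= target + 1) hY.
rewrite -/eg -/ml.
set err := 2 * _ * _ * _ / _ => hres.
have herr : err <= 1.
  apply/Rle_div_l; first exact: INR_gt0.
  have hD : INR D.+1 <= 2 * S ^ 2 by rewrite S_INR; lra.
  have hB : (1 + ln (INR N)) ^ l <= L ^ (7 * l).
    rewrite (_ : (7 * l)%N = (7 * l)%coq_nat) // pow_mult; apply: pow_incr.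
    by have := ln_INR_ge0 N0; lra.
  have hE : exp (48 * (INR x / ln (INR x))) <= S by exact: exp_mono.
  have h8 : 8 * L ^ (7 * l) <= S by nra.
  have hB0 : 0 <= (1 + ln (INR N)) ^ l by apply: pow_le; have := ln_INR_ge0 N0; lra.
  apply: (Rle_trans _ (2 * (2 * S ^ 2) * L ^ (7 * l) * S)).
    apply: Rmult_le_compat => //; [|exact: Rlt_le (exp_pos _)|].
      by apply: Rmult_le_pos => //; have := pos_INR D.+1; lra.
    apply: Rmult_le_compat => //; have := pos_INR D.+1; lra.
  rewrite Rmult_1_l; apply: Rle_trans KT; rewrite TS.
  have : 8 * L ^ (7 * l) * S ^ 3 <= S * S ^ 3 by apply: Rmult_le_compat_r => //; apply: pow_le; lra.
  rewrite /=; lra.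
have hpow : a ^ l + INR l * a ^ (l - 1) * (ln a - c2) <= (ln (INR x) - ml) ^ l.
  apply: (Rle_trans _ ((a + (ln a - c2)) ^ l)).
    have := @pow_add_ge (l - 1) a (ln a - c2); rewrite -subSn // subSS subn0.
    by apply; lra.
  by apply: pow_incr; rewrite /c2 in ha2 *; lra.
have a1 : 1 <= a ^ (l - 1) by apply: pow_R1_Rle; lra.
have hfin := Rmult_le_compat_l _ _ _ (Rlt_le _ _ eg0) hpow.
have e1 : eg * (a ^ l + INR l * a ^ (l - 1) * (ln a - c2)) = target + 3 * a ^ (l - 1).
  by rewrite /target /C; field; lra.
lra.
Qed.

End LargeValues.

Theorem theorem1 (l : nat) (hl : (1 <= l)%nat) :
  exists C T0 : R, 0 < C /\
    forall T : R, T0 <= T ->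
      exists t : R, sqrt T <= t <= T /\
        prodR (fun j => zeta1_abs (INR j * t)) l >=
        exp (INR l * euler_gamma) *
          ( ln (ln T) ^ l
            + INR l * ln (ln T) ^ (l - 1) * ln (ln (ln T))
            - C * ln (ln T) ^ (l - 1) ).
Proof. exact (LargeValues.large_values (ssrbool.introT ssrnat.leP hl)). Qed.
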